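(* Let $x_1,\dots,x_n$, $a_1,\dots,a_n$, and $t$ be indeterminates. For each $j=1,\dots,n$, let $P_j$ be an $A_{j-1}$ theta function of norm $ta_1\cdots a_j$. Then $$\det_{1\le i,j\le n}\left(P_j(x_i)\prod_{k=j+1}^n\theta(a_kx_i)\right)=\frac{\theta(ta_1\cdots a_nx_1\cdots x_n)}{\theta(t)}\prod_{i=1}^nP_i(1/a_i)\prod_{1\le i<j\le n}a_jx_j\,\theta(x_i/x_j).$$
   Context: Fix $p\in\mathbb C$ with $0<|p|<1$. Put $(a;p)_\infty=\prod_{j\ge0}(1-ap^j)$ and $\theta(x)=\theta(x;p)=(x;p)_\infty(p/x;p)_\infty$ for $x\ne0$. A function $f$ holomorphic on $\mathbb C\setminus\{0\}$ is called an $A_{m-1}$ theta function of norm $s$ (with $m\ge1$ and $s\in\mathbb C\setminus\{0\}$) if $f(px)=\frac{(-1)^m}{s x^m}f(x)$ for all $x\neq0$. ''Indeterminates'' are understood as nonzero complex numbers, assumed generic so that no denominators vanish. *)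

(* Defs.v *)
From HB Require Import structures.
From mathcomp Require Import all_boot all_order all_algebra.
From mathcomp Require Import all_classical all_reals all_analysis.
From mathcomp Require Import complex.

Set Implicit Arguments.
Unset Strict Implicit.
Unset Printing Implicit Defensive.

Import Order.TTheory GRing.Theory Num.Theory.
Import numFieldNormedType.Exports.

Local Open Scope classical_set_scope.
Local Open Scope ring_scope.
Local Open Scope complex_scope.

(* The field of complex numbers is R[i] for R : realType. Its topology is that
   of a numFieldType: balls for the modulus. R[i]^o is R[i] seen as a normed
   module over itself, so that [derivable f z 1] is complex
   differentiability. *)

(* The infinite product (a; p)_oo, which converges for `|p| < 1. *)
Definition pochhammer_inf (R : realType) (p a : R[i]) : R[i] :=
  limn (fun N : nat => (\prod_(j < N) (1 - a * p ^+ j) : R[i]^o)).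

Definition theta (R : realType) (p x : R[i]) : R[i] :=
  pochhammer_inf p x * pochhammer_inf p (p / x).

Definition holomorphic_on (R : realType) (D : set R[i]) (f : R[i] -> R[i]) : Prop :=
  forall z : R[i], D z -> derivable (f : R[i]^o -> R[i]^o) z 1.

(* [A_theta_function p m s f]: f is an A_{m-1} theta function of norm s (and
   nome p). The value of f at 0 is irrelevant. *)
Definition A_theta_function (R : realType) (p : R[i]) (m : nat) (s : R[i])
    (f : R[i] -> R[i]) : Prop :=
  [/\ (0 < m)%N, s != 0, holomorphic_on [set z | z != 0] f &
      forall x : R[i], x != 0 -> f (p * x) = (-1) ^+ m / (s * x ^+ m) * f x].

(* Main.v *)
Require Import Defs.
From HB Require Import structures.
From mathcomp Require Import all_boot all_order all_algebra.
From mathcomp Require Import all_classical all_reals all_analysis.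
From mathcomp Require Import complex.
From mathcomp Require Import perm ring lra.

Set Implicit Arguments.
Unset Strict Implicit.
Unset Printing Implicit Defensive.

Import Order.TTheory GRing.Theory Num.Theory.
Import numFieldNormedType.Exports.
Import ComplexField.Normc.

Local Open Scope classical_set_scope.
Local Open Scope ring_scope.
Local Open Scope complex_scope.

(** Fix all points but the last one, y.  By the quasi-periodicity of theta, each
    column j of the matrix is, as a function of its point, an A_(n-1) theta
    function of norm s = t a_1 ... a_n (theta_entry_A_theta); hence so is the
    determinant as a function of y.  The right-hand side has the same property
    (theta_rhs_last).  Both sides vanish when y is one of the other points, and
    at y = 1/a_n they agree by induction: there all entries of the last row but
    the last one contain the factor theta(1) = 0, and the remaining minor is the
    matrix of size n-1 with its rows rescaled by theta(a_n x_i).  So the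
    difference of the two sides is an A_(n-1) theta function with n prescribed
    zeros, and it is identically zero as soon as these zeros b_i are pairwise
    distinct modulo powers of p and theta(s b_1 ... b_n) is nonzero
    (A_theta_uniqueness).  Points which violate these conditions are limits of
    points which satisfy them: along the curve x_i z^i the conditions hold for
    all real z slightly larger than 1, because theta vanishes only at the powers
    of p (generic_perturbation).

    The uniqueness statement says that the space of A_(m-1) theta functions of
    norm s has dimension at most m.  Indeed the functional equation ties the
    Laurent coefficient of index k + m to the one of index k, so that m
    consecutive coefficients determine all of them (laurent_coef_rec), and a
    function holomorphic on the punctured plane whose Laurent coefficients all
    vanish is zero (laurent_uniqueness).  On the other hand there are m such
    functions dual to the evaluations at the b_i (lagrange_theta).

    The complex analysis behind this is developed from complex differentiability
    alone.  A Laurent coefficient is an integral over a circle; it does not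
    depend on the radius, nor on a rotation, of the circle by Goursat's bisection
    argument applied to the composite with the exponential
    (goursat_parallelogram, circle_int_dilation).  Uniqueness then follows by
    integrating against powers of a trigonometric polynomial with a single peak
    (peak_kernel).  That theta itself is holomorphic comes from Taylor bounds for
    the partial products, uniform in the number of factors
    (pochhammer_bounds). *)

Local Notation Re := (@complex.Re _).
Local Notation Im := (@complex.Im _).

(** * Integrals of continuous functions over a segment *)

Section RealIntegral.
Variable R : realType.
Implicit Types (h k H : R -> R) (a b c : R).

Definition rint h a b : R := (\int[lebesgue_measure]_(x in `[a, b]) h x)%R.

Lemma cont_within h (A : set R) : continuous h -> {within A, continuous h}.
Proof. exact: continuous_subspaceT. Qed.

Lemma rint_FTC h H a b : a < b -> continuous h ->
  (forall x, a <= x <= b -> is_derive x 1 H (h x)) -> rint h a b = H b - H a.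
Proof.
move=> ab ch dH.
have cH x : a <= x <= b -> {for x, continuous H}.
  by move=> /dH [dHx _]; apply/differentiable_continuous/derivable1_diffP.
rewrite /rint /Rintegral (@continuous_FTC2 _ h H) //=.
- exact: cont_within.
- split.
  + by move=> x /[!in_itv]/= /andP[ax xb]; case: (dH x) => //; rewrite !ltW.
  + by apply: cvg_at_right_filter; apply: cH; rewrite lexx ltW.
  + by apply: cvg_at_left_filter; apply: cH; rewrite lexx ltW.
- move=> x /[!in_itv]/= /andP[ax xb]; rewrite derive1E.
  by case: (dH x) => //; rewrite !ltW.
Qed.

(** The integral starts at a - 1 and is bounded by b + 1, so that the fundamental
    theorem of calculus applies at the end points a and b as well. *)
Lemma primitive_ex h a b : continuous h ->
  exists H, forall x, a <= x <= b -> is_derive x 1 H (h x).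
Proof.
move=> ch.
exists (fun x => (\int[lebesgue_measure]_(t in `[a - 1, x]) h t)%R) => x /andP[ax xb].
have ih : lebesgue_measure.-integrable `[a - 1, b + 1] (EFin \o h).
  by apply: continuous_compact_integrable;
    [exact: segment_compact | exact: cont_within].
have [| |d1 d2] := @continuous_FTC1_closed _ h (a - 1) x (b + 1) _ ih _ (ch x).
- by rewrite (le_lt_trans xb) // ltrDl.
- by rewrite (lt_le_trans _ ax) // gtrBl.
- by split; [exact: d1|rewrite -derive1E].
Qed.

Lemma rint_split h a b c : a < b -> b < c -> continuous h ->
  rint h a c = rint h a b + rint h b c.
Proof.
move=> ab bc ch; have [H dH] := primitive_ex a c ch.
have ac := lt_trans ab bc.
rewrite (rint_FTC ac ch dH).
have -> : rint h a b = H b - H a.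
  by apply: rint_FTC => // x /andP[ax xb]; apply: dH; rewrite ax (le_trans xb (ltW bc)).
have -> : rint h b c = H c - H b.
  by apply: rint_FTC => // x /andP[bx xc]; apply: dH; rewrite xc (le_trans (ltW ab) bx).
by ring.
Qed.

Lemma rint_lin (u v : R) h k a b : a < b -> continuous h -> continuous k ->
  rint (fun x => u * h x + v * k x) a b = u * rint h a b + v * rint k a b.
Proof.
move=> ab ch ck.
have [H dH] := primitive_ex a b ch; have [K dK] := primitive_ex a b ck.
rewrite (rint_FTC ab ch dH) (rint_FTC ab ck dK).
have -> : rint (fun x => u * h x + v * k x) a b =
    (u * H b + v * K b) - (u * H a + v * K a).
  apply: (rint_FTC (H := fun x => u * H x + v * K x)) => //.
    by move=> x; apply: cvgD; apply: cvgM; try exact: cvg_cst;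
      [exact: ch|exact: ck].
  move=> x xab; have dHx := dH x xab; have dKx := dK x xab.
  exact: (is_deriveD (is_deriveZ u dHx) (is_deriveZ v dKx)).
by ring.
Qed.

Lemma rint_bound h a b m M : a < b -> continuous h ->
  (forall x, a <= x <= b -> m <= h x <= M) ->
  m * (b - a) <= rint h a b <= M * (b - a).
Proof.
move=> ab ch hb; have [H dH] := primitive_ex a b ch.
rewrite (rint_FTC ab ch dH).
have [x xab ->] : exists2 x, x \in `[a, b] & H b - H a = h x * (b - a).
  apply: MVT_segment; first exact: ltW.
    by move=> x /[!in_itv]/= /andP[ax xb]; apply: dH; rewrite !ltW.
  apply: derivable_within_continuous => x; rewrite in_itv /= => xab.
  by case: (dH x xab).
have := hb x xab; rewrite in_itv /= in xab *.
have ba : 0 < b - a by rewrite subr_gt0.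
by rewrite !ler_pM2r.
Qed.

End RealIntegral.

Section ComplexIntegral.
Variable R : realType.
Implicit Types (h k : R -> R[i]) (a b : R).

Definition ccont h := continuous (Re \o h : R -> R) /\ continuous (Im \o h : R -> R).

Definition cint h a b : R[i] := (rint (Re \o h) a b) +i* (rint (Im \o h) a b).

Lemma ccontD h k : ccont h -> ccont k -> ccont (fun x => h x + k x).
Proof.
move=> [h1 h2] [k1 k2]; split=> x.
- have -> : Re \o (fun x => h x + k x) = (Re \o h) \+ (Re \o k).
    by apply/funext => y /=; case: (h y) (k y) => [? ?] [].
  by apply: cvgD; [exact: h1|exact: k1].
- have -> : Im \o (fun x => h x + k x) = (Im \o h) \+ (Im \o k).
    by apply/funext => y /=; case: (h y) (k y) => [? ?] [].
  by apply: cvgD; [exact: h2|exact: k2].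
Qed.

Lemma ccontM h k : ccont h -> ccont k -> ccont (fun x => h x * k x).
Proof.
move=> [h1 h2] [k1 k2]; split=> x.
- have -> : Re \o (fun x => h x * k x) =
    fun x => Re (h x) * Re (k x) - Im (h x) * Im (k x).
    by apply/funext => y /=; case: (h y) (k y) => [? ?] [].
  by apply: cvgB; apply: cvgM; [exact: h1|exact: k1|exact: h2|exact: k2].
- have -> : Im \o (fun x => h x * k x) =
    fun x => Re (h x) * Im (k x) + Im (h x) * Re (k x).
    by apply/funext => y /=; case: (h y) (k y) => [? ?] [].
  by apply: cvgD; apply: cvgM; [exact: h1|exact: k2|exact: h2|exact: k1].
Qed.

Lemma ccont_cst (z : R[i]) : ccont (fun=> z).
Proof. by split=> x; exact: cvg_cst. Qed.

Lemma cint_split h a b (c : R) : a < b -> b < c -> ccont h ->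
  cint h a c = cint h a b + cint h b c.
Proof. by move=> ab bc [h1 h2]; rewrite /cint !(@rint_split _ _ a b c). Qed.

Lemma cint_lin (u v : R[i]) h k a b : a < b -> ccont h -> ccont k ->
  cint (fun x => u * h x + v * k x) a b = u * cint h a b + v * cint k a b.
Proof.
move=> ab ch ck; rewrite /cint.
case: ch => h1 h2; case: ck => k1 k2.
case: u => u1 u2; case: v => v1 v2.
have cc (p q : R) (f g : R -> R) : continuous f -> continuous g ->
    continuous (fun x => p * f x + q * g x).
  move=> cf cg x; apply: cvgD; apply: cvgM; try exact: cvg_cst; [exact: cf|exact: cg].
have -> : Re \o (fun x => (u1 +i* u2) * h x + (v1 +i* v2) * k x) =
  fun x => 1 * (u1 * (Re \o h) x + (- u2) * (Im \o h) x) +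
           1 * (v1 * (Re \o k) x + (- v2) * (Im \o k) x).
  apply/funext => x /=; case: (h x) (k x) => [? ?] [? ?] /=; ring.
have -> : Im \o (fun x => (u1 +i* u2) * h x + (v1 +i* v2) * k x) =
  fun x => 1 * (u2 * (Re \o h) x + u1 * (Im \o h) x) +
           1 * (v2 * (Re \o k) x + v1 * (Im \o k) x).
  apply/funext => x /=; case: (h x) (k x) => [? ?] [? ?] /=; ring.
rewrite !(rint_lin _ _ ab) //; try exact: cc.
by apply/eqP; rewrite eq_complex /=; apply/andP; split; apply/eqP; ring.
Qed.

Lemma cintZ (u : R[i]) h a b : a < b -> ccont h ->
  cint (fun x => u * h x) a b = u * cint h a b.
Proof.
move=> ab ch; have := cint_lin u 0 ab ch ch; rewrite mul0r addr0 => <-.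
by congr cint; apply/funext => x; rewrite mul0r addr0.
Qed.

Lemma cintD h k a b : a < b -> ccont h -> ccont k ->
  cint (fun x => h x + k x) a b = cint h a b + cint k a b.
Proof.
move=> ab ch ck; have := cint_lin 1 1 ab ch ck; rewrite !mul1r => <-.
by congr cint; apply/funext => x; rewrite !mul1r.
Qed.

Lemma cintB h k a b : a < b -> ccont h -> ccont k ->
  cint (fun x => h x - k x) a b = cint h a b - cint k a b.
Proof.
move=> ab ch ck; have := cint_lin 1 (-1) ab ch ck; rewrite !mul1r mulN1r => <-.
by congr cint; apply/funext => x; rewrite mulN1r mul1r.
Qed.

Lemma normc_Re (z : R[i]) : `|Re z| <= normc z.
Proof.
by case: z => x y /=; rewrite -sqrtr_sqr ler_wsqrtr // lerDl sqr_ge0.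
Qed.

Lemma normc_Im (z : R[i]) : `|Im z| <= normc z.
Proof.
by case: z => x y /=; rewrite -sqrtr_sqr ler_wsqrtr // lerDr sqr_ge0.
Qed.

Lemma normc_ge0 (z : R[i]) : 0 <= normc z.
Proof. by case: z => x y /=; exact: sqrtr_ge0. Qed.

Lemma normc_gt0 (z : R[i]) : z != 0 -> 0 < normc z.
Proof.
move=> z0; rewrite lt_neqAle normc_ge0 andbT eq_sym.
by apply: contra z0 => /eqP/eq0_normc ->.
Qed.

Lemma normcD (y z : R[i]) : normc (y + z) <= normc y + normc z.
Proof. exact: le_normcD. Qed.

Lemma normc_le (z : R[i]) : normc z <= `|Re z| + `|Im z|.
Proof.
have := complexE z => {1}->; apply: (le_trans (le_normcD _ _)).
rewrite normcM /= !expr0n /= expr1n add0r sqrtr1 mul1r !addr0 !sqrtr_sqr //.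
Qed.

(** The factor 2 is lost because real and imaginary parts are estimated
    separately; only the order of magnitude matters in Goursat's theorem. *)
Lemma cint_near h (c : R[i]) a b K : a < b -> ccont h ->
  (forall x, a <= x <= b -> normc (h x - c) <= K) ->
  normc (cint h a b - c * (b - a)%:C) <= 2 * K * (b - a).
Proof.
move=> ab [h1 h2]; case: c => c1 c2 hK.
have bR : `|rint (Re \o h) a b - c1 * (b - a)| <= K * (b - a).
  have : forall x, a <= x <= b -> c1 - K <= (Re \o h) x <= c1 + K.
    move=> x /hK; move/(le_trans (normc_Re _)); rewrite ler_norml.
    
    by move=> /=; case: (h x) => [p q] /= /andP[l1 l2]; apply/andP; split; lra.
  by move=> /(rint_bound ab h1); rewrite ler_norml => /andP[l1 l2]; apply/andP; split; lra.
have bI : `|rint (Im \o h) a b - c2 * (b - a)| <= K * (b - a).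
  have : forall x, a <= x <= b -> c2 - K <= (Im \o h) x <= c2 + K.
    move=> x /hK; move/(le_trans (normc_Im _)); rewrite ler_norml.
    
    by move=> /=; case: (h x) => [p q] /= /andP[l1 l2]; apply/andP; split; lra.
  by move=> /(rint_bound ab h2); rewrite ler_norml => /andP[l1 l2]; apply/andP; split; lra.
apply: (le_trans (normc_le _)); move: bR bI; rewrite /cint /=.
set U := `|_|; set V := `|_|; set U' := `|_|; set V' := `|_|.
suff : U = U' /\ V = V' by move=> [-> ->]; lra.
by split; congr `|_|; ring.
Qed.

End ComplexIntegral.

(** * Goursat's theorem for parallelograms *)

(** Clearing the denominator of the difference quotient gives an estimate that
    can be integrated. *)
Lemma derivable_epsP (K : numFieldType) (f : K -> K) (w D : K) :
  (h^-1 *: (((f : K^o -> K^o) \o shift w) (h *: (1 : K^o)) - f w)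
     @[h --> (0 : K^o)^'] --> (D : K^o)) <->
  (forall e : K, 0 < e -> exists2 d : K, 0 < d & forall z, `|z - w| < d ->
     `|f z - f w - D * (z - w)| <= e * `|z - w|).
Proof.
split.
- move=> /cvgrPdist_le H e e0; have [d /= d0 Hd] := H e e0.
  exists d => // z zw.
  have [->|zNw] := eqVneq z w; first by rewrite !subrr mulr0 subr0 normr0 mulr0.
  have zw0 : z - w != 0 by rewrite subr_eq0.
  have := Hd (z - w) _ zw0.
  rewrite /ball_ /= sub0r normrN => /(_ zw).
  rewrite /shift /= [_ *: 1]mulr1 subrK => le1.
  have -> : f z - f w - D * (z - w) =
     - ((D - (z - w)^-1 * (f z - f w)) * (z - w)).
    by rewrite mulrBl mulrAC mulVf // mul1r opprB.
  by rewrite normrN normrM ler_wpM2r.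
- move=> H; apply/cvgrPdist_le => e e0.
  have [d d0 Hd] := H e e0.
  exists d => // h; rewrite /ball_ /= sub0r normrN => hd h0.
  have := Hd (h + w); rewrite addrK => /(_ hd) => {}Hd.
  rewrite /shift /= [_ *: 1]mulr1; move: Hd.
  set X := f (h + w) - f w => le1.
  rewrite -(@ler_pM2r _ `|h|) ?normr_gt0 // -normrM.
  have -> : (D - h^-1 * X) * h = - (X - D * h).
    by rewrite mulrBl mulrAC mulVf // mul1r [RHS]opprB.
  by rewrite normrN.
Qed.

Section ComplexDerivative.
Variable R : realType.
Implicit Types (F G : R[i] -> R[i]) (w z : R[i]).

Lemma normcE z : `|z| = (normc z)%:C. Proof. by []. Qed.

Lemma pos_complex (e : R[i]) : 0 < e -> exists2 r : R, 0 < r & e = r%:C.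
Proof.
case: e => x y; rewrite ltcE /= => /andP[/eqP -> x0]; by exists x.
Qed.

Lemma derivable_eps F w : derivable (F : R[i]^o -> R[i]^o) w 1 -> exists D,
  forall e : R, 0 < e -> exists2 d : R, 0 < d & forall z, normc (z - w) < d ->
     normc (F z - F w - D * (z - w)) <= e * normc (z - w).
Proof.
move=> /cvg_ex[D /derivable_epsP HD]; exists D => e e0.
have /HD [_ /pos_complex[d d0 ->] Hd] : 0 < e%:C by rewrite ltcR.
exists d => // z zw; have := Hd z; rewrite !normcE -rmorphM lecR; apply.
by rewrite ltcR.
Qed.

Lemma eps_derivable F w D :
  (forall e : R, 0 < e -> exists2 d : R, 0 < d & forall z, normc (z - w) < d ->
     normc (F z - F w - D * (z - w)) <= e * normc (z - w)) ->
  derivable (F : R[i]^o -> R[i]^o) w 1.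
Proof.
move=> H; apply/cvg_ex; exists D; apply/derivable_epsP.
move=> _ /pos_complex[e e0 ->]; have [d d0 Hd] := H e e0.
exists d%:C; first by rewrite ltcR.
by move=> z; rewrite !normcE ltcR -rmorphM lecR; exact: Hd.
Qed.

Lemma derivable_cont F w : derivable (F : R[i]^o -> R[i]^o) w 1 ->
  {for w, continuous (F : R[i]^o -> R[i]^o)}.
Proof. by move=> /derivable1_diffP; exact: differentiable_continuous. Qed.

Lemma Re_continuous : continuous (Re : R[i]^o -> R).
Proof.
move=> w; apply/(@cvgrPdist_lt R R _ (nbhs (w : R[i]^o)) (nbhs_filter (w : R[i]^o))).
move=> e e0.
exists e%:C; first by rewrite /= ltcR.
move=> z; rewrite /ball_ /= ltcR; apply: le_lt_trans.
by have := normc_Re (w - z); case: w z => [? ?] [].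
Qed.

Lemma Im_continuous : continuous (Im : R[i]^o -> R).
Proof.
move=> w; apply/(@cvgrPdist_lt R R _ (nbhs (w : R[i]^o)) (nbhs_filter (w : R[i]^o))).
move=> e e0.
exists e%:C; first by rewrite /= ltcR.
move=> z; rewrite /ball_ /= ltcR; apply: le_lt_trans.
by have := normc_Im (w - z); case: w z => [? ?] [].
Qed.

Lemma real_complex_continuous : continuous (fun x : R => x%:C : R[i]^o).
Proof.
move=> x; apply/cvgrPdist_lt => _ /pos_complex[e e0 ->].
exists e => // z; rewrite /ball_ /= => xz.
by rewrite -rmorphB normcE ltcR /= expr0n addr0 sqrtr_sqr.
Qed.

Lemma ccont_continuous (h : R -> R[i]) :
  continuous (h : R -> R[i]^o) -> ccont h.
Proof.
move=> ch; split=> x.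
- by apply: (@continuous_comp R R[i]^o R h Re); [exact: ch|exact: Re_continuous].
- by apply: (@continuous_comp R R[i]^o R h Im); [exact: ch|exact: Im_continuous].
Qed.

Lemma ccont_affine G (z v : R[i]) :
  (forall w, derivable (G : R[i]^o -> R[i]^o) w 1) ->
  ccont (fun t : R => G (z + t%:C * v)).
Proof.
move=> dG; apply: ccont_continuous => t.
apply: (@continuous_comp R R[i]^o R[i]^o
  (fun t : R => z + t%:C * v : R[i]^o) (G : R[i]^o -> R[i]^o)).
  apply: cvgD; first exact: cvg_cst.
  by apply: cvgM; [exact: real_complex_continuous|exact: cvg_cst].
exact: derivable_cont.
Qed.

End ComplexDerivative.

Lemma nested_intervals (R : realType) (s a : nat -> R) :
  (forall n, 0 <= a n) -> (forall n, s n <= s n.+1) ->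
  (forall n, s n.+1 + a n.+1 <= s n + a n) ->
  exists l, forall n, s n <= l <= s n + a n.
Proof.
move=> a0 sS saS.
have smono m n : (m <= n)%N -> s m <= s n.
  move=> /subnK <-; elim: (n - m)%N => [|k IH] //.
  by rewrite addSn (le_trans IH).
have samono m n : (m <= n)%N -> s n + a n <= s m + a m.
  move=> /subnK <-; elim: (n - m)%N => [|k IH] //.
  by rewrite addSn (le_trans _ IH).
have sle m n : s m <= s n + a n.
  have [mn|nm] := leqP m n.
    by rewrite (le_trans (smono _ _ mn)) // lerDl.
  by rewrite (le_trans _ (samono _ _ (ltnW nm))) // lerDl.
have ub n : ubound (range s) (s n + a n) by move=> _ [m _ <-].
exists (sup (range s)) => n; apply/andP; split.
  by apply: ub_le_sup; [exists (s 0%N + a 0%N); exact: ub|exists n].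
by apply: ge_sup; [exists (s 0%N), 0%N|exact: ub].
Qed.

(** The bisection step of Goursat's theorem: by the triangle inequality one of
    the four quarters carries at least a quarter of the total. *)
Lemma largest_quarter (R : realType) (e : R -> R -> R[i]) (x y a b k : R) :
  0 < a -> 0 < b -> exists q : R * R,
    4 * k <= normc (e x y + e (x + a) y + e x (y + b) + e (x + a) (y + b)) ->
    [/\ k <= normc (e q.1 q.2), x <= q.1, q.1 + a <= x + (a + a),
        y <= q.2 & q.2 + b <= y + (b + b)].
Proof.
move=> a0 b0.
have [h1|h1] := leP k (normc (e x y)).
  by exists (x, y) => _ /=; split=> //; lra.
have [h2|h2] := leP k (normc (e (x + a) y)).
  by exists (x + a, y) => _ /=; split=> //; lra.
have [h3|h3] := leP k (normc (e x (y + b))).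
  by exists (x, y + b) => _ /=; split=> //; lra.
have [h4|h4] := leP k (normc (e (x + a) (y + b))).
  by exists (x + a, y + b) => _ /=; split=> //; lra.
exists (x, y) => le; exfalso; move: h1 h2 h3 h4 le.
move: (e x y) (e (x + a) y) (e x (y + b)) (e (x + a) (y + b)) => e1 e2 e3 e4.
have := normcD (e1 + e2 + e3) e4; have := normcD (e1 + e2) e3.
have := normcD e1 e2; lra.
Qed.

Section Goursat.
Variables (R : realType) (G : R[i] -> R[i]) (u v w0 : R[i]).
Hypothesis dG : forall w, derivable (G : R[i]^o -> R[i]^o) w 1.

Let pt (s t : R) : R[i] := w0 + s%:C * u + t%:C * v.
Let g (s t : R) := G (pt s t).
(** The integral along the boundary of the parallelogram spanned by [a * u] and [b * v]. *)
Let E (s t a b : R) :=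
  v * cint (fun y => g (s + a) y - g s y) t (t + b)
  - u * cint (fun x => g x (t + b) - g x t) s (s + a).

Let cg1 s : ccont (g s). Proof. exact: ccont_affine. Qed.

Let cg2 t : ccont (g ^~ t).
Proof.
have := ccont_affine (w0 + t%:C * v) u dG; congr ccont.
by apply/funext => x; rewrite /g /pt addrAC.
Qed.

Let Y x t b := cint (g x) t (t + b).
Let X y s a := cint (g ^~ y) s (s + a).

Let E_ends s t a b : 0 < a -> 0 < b ->
  E s t a b = v * (Y (s + a) t b - Y s t b) - u * (X (t + b) s a - X t s a).
Proof.
move=> a0 b0; congr (v * _ - u * _); apply: cintB; rewrite ?ltrDl //;
  solve [exact: cg1 | exact: cg2].
Qed.

Let Y_split x t b : 0 < b -> Y x t (b + b) = Y x t b + Y x (t + b) b.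
Proof.
move=> b0; rewrite /Y (addrA t) (@cint_split _ _ t (t + b)) ?ltrDl //.
Qed.

Let X_split y s a : 0 < a -> X y s (a + a) = X y s a + X y (s + a) a.
Proof.
move=> a0; rewrite /X (addrA s) (@cint_split _ _ s (s + a)) ?ltrDl //.
Qed.

Let split_identity (K : comNzRingType) (p q y0 y1 y2 z0 z1 z2 x0 x1 x2 w1 w2 w3 : K) :
  p * (y2 + z2 - (y0 + z0)) - q * (x2 + w3 - (x0 + w1)) =
  (p * (y1 - y0) - q * (x1 - x0)) + (p * (y2 - y1) - q * (w2 - w1)) +
  (p * (z1 - z0) - q * (x2 - x1)) + (p * (z2 - z1) - q * (w3 - w2)).
Proof. by ring. Qed.

Let E_split s t a b : 0 < a -> 0 < b ->
  E s t (a + a) (b + b) =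
  E s t a b + E (s + a) t a b + E s (t + b) a b + E (s + a) (t + b) a b.
Proof.
move=> a0 b0; rewrite !E_ends ?addr_gt0 // !Y_split // !X_split //.
rewrite (addrA s a a) (addrA t b b); exact: split_identity.
Qed.

(** The affine part of [G] at [pt s t], with slope [D], contributes
   [v * (D * a * u) * b - u * (D * b * v) * a = 0]; what remains is the error term of
   the derivative, integrated over the edges. *)
Let E_local s t (e : R) : 0 < e -> exists2 d : R, 0 < d &
  forall s1 t1 a b, 0 < a -> 0 < b -> s1 <= s <= s1 + a -> t1 <= t <= t1 + b ->
    a + b < d -> normc (E s1 t1 a b) <= e * (a + b) ^+ 2.
Proof.
move=> e0; set M := normc u + normc v + 1.
have nu := normc_ge0 u; have nv := normc_ge0 v.
have M0 : 0 < M by rewrite /M; lra.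
have [D HD] := derivable_eps (@dG (pt s t)).
have e'0 : 0 < e / (4 * M ^+ 2) by rewrite divr_gt0 // mulr_gt0 // exprn_gt0.
have [d d0 {}HD] := HD _ e'0; move: e'0 HD; set e' := _ / _ => e'0 HD.
exists (d / M); first exact: divr_gt0.
move=> s1 t1 a b a0 b0 /andP[s1s ss1] /andP[t1t tt1]; rewrite ltr_pdivlMr // => abd.
have near x y : s1 <= x <= s1 + a -> t1 <= y <= t1 + b ->
    normc (g x y - g s t - D * (pt x y - pt s t)) <= e' * ((a + b) * M).
  move=> /andP[x1 x2] /andP[y1 y2].
  have nb : normc (pt x y - pt s t) <= (a + b) * M.
    have -> : pt x y - pt s t = (x - s)%:C * u + (y - t)%:C * v.
      by rewrite /pt !rmorphB /=; ring.
    apply: (le_trans (normcD _ _)); rewrite !normcM /= expr0n /= !addr0 !sqrtr_sqr.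
    have xs : `|x - s| <= a by rewrite ler_norml; apply/andP; split; lra.
    have yt : `|y - t| <= b by rewrite ler_norml; apply/andP; split; lra.
    have := ler_wpM2r nu xs; have := ler_wpM2r nv yt; rewrite /M; nra.
  apply: (le_trans (HD _ (le_lt_trans nb abd))).
  by rewrite ler_pM2l.
have i1 : normc (cint (fun y => g (s1 + a) y - g s1 y) t1 (t1 + b) - D * (a%:C * u) * b%:C)
          <= 2 * (2 * (e' * ((a + b) * M))) * b.
  have tb : t1 < t1 + b by rewrite ltrDl.
  have cc : ccont (fun y => g (s1 + a) y - g s1 y).
    have -> : (fun y => g (s1 + a) y - g s1 y) = fun y => g (s1 + a) y + (-1) * g s1 y.
      by apply/funext => y; rewrite mulN1r.
    by apply: ccontD => //; apply: ccontM => //; exact: ccont_cst.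
  have := @cint_near R _ (D * (a%:C * u)) _ _ (2 * (e' * ((a + b) * M))) tb cc.
  have -> : t1 + b - t1 = b by ring.
  apply=> y yb.
  have n1 := near (s1 + a) y; have n2 := near s1 y.
  have -> : g (s1 + a) y - g s1 y - D * (a%:C * u) =
    (g (s1 + a) y - g s t - D * (pt (s1 + a) y - pt s t))
    - (g s1 y - g s t - D * (pt s1 y - pt s t)).
    by rewrite /pt !rmorphD /=; ring.
  apply: (le_trans (normcD _ _)); rewrite normcN mulr_natl mulr2n lerD //.
    by apply: n1 => //; rewrite lexx lerDl ltW.
  by apply: n2 => //; rewrite lexx lerDl ltW.
have i2 : normc (cint (fun x => g x (t1 + b) - g x t1) s1 (s1 + a) - D * (b%:C * v) * a%:C)
          <= 2 * (2 * (e' * ((a + b) * M))) * a.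
  have sa : s1 < s1 + a by rewrite ltrDl.
  have cc : ccont (fun x => g x (t1 + b) - g x t1).
    have -> : (fun x => g x (t1 + b) - g x t1) = fun x => g x (t1 + b) + (-1) * g x t1.
      by apply/funext => y; rewrite mulN1r.
    by apply: ccontD => //; apply: ccontM => //; exact: ccont_cst.
  have := @cint_near R _ (D * (b%:C * v)) _ _ (2 * (e' * ((a + b) * M))) sa cc.
  have -> : s1 + a - s1 = a by ring.
  apply=> y yb.
  have n1 := near y (t1 + b); have n2 := near y t1.
  have -> : g y (t1 + b) - g y t1 - D * (b%:C * v) =
    (g y (t1 + b) - g s t - D * (pt y (t1 + b) - pt s t))
    - (g y t1 - g s t - D * (pt y t1 - pt s t)).
    by rewrite /pt !rmorphD /=; ring.
  apply: (le_trans (normcD _ _)); rewrite normcN mulr_natl mulr2n lerD //.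
    by apply: n1 => //; rewrite lexx lerDl ltW.
  by apply: n2 => //; rewrite lexx lerDl ltW.
rewrite /E; move: i1 i2; set I1 := cint _ _ _; set I2 := cint _ _ _ => i1 i2.
have -> : v * I1 - u * I2 =
  v * (I1 - D * (a%:C * u) * b%:C) - u * (I2 - D * (b%:C * v) * a%:C) by ring.
apply: (le_trans (normcD _ _)); rewrite normcN !normcM.
have j1 := ler_wpM2l nv i1; have j2 := ler_wpM2l nu i2.
have -> : e = e' * (4 * M ^+ 2).
  by rewrite /e' divfK // gt_eqF // mulr_gt0 // exprn_gt0.
set K := e' * ((a + b) * M) in j1 j2.
have K0 : 0 < K by rewrite /K mulr_gt0 // mulr_gt0 // addr_gt0.
have -> : e' * (4 * M ^+ 2) * (a + b) ^+ 2 = 4 * K * ((a + b) * M) by rewrite /K; ring.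
apply: (le_trans (lerD j1 j2)).
have -> : normc v * (2 * (2 * K) * b) + normc u * (2 * (2 * K) * a) =
          4 * K * (normc v * b + normc u * a) by ring.
have K4 : 0 < 4 * K by rewrite mulr_gt0.
rewrite (ler_pM2l K4) /M.
have := mulr_ge0 nv (ltW a0); have := mulr_ge0 nu (ltW b0).
by move: (normc u) (normc v) => x y; nra.
Qed.

(** The two sides are integrals of [G] over opposite pairs of edges of a
    parallelogram, so their difference is the integral of [G] along its boundary.
    If it were nonzero, repeated bisection would produce a sequence of
    parallelograms shrinking to a point on which it decreases at most like the
    area, against the local estimate at that point.  The sides [u] and [v] are
    arbitrary complex numbers, so rotations and changes of radius of a circle are
    treated at once after composition with the exponential. *)
Lemma goursat_parallelogram s t a b : 0 < a -> 0 < b ->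
  v * cint (fun y => G (w0 + (s + a)%:C * u + y%:C * v) - G (w0 + s%:C * u + y%:C * v))
        t (t + b)
  = u * cint (fun x => G (w0 + x%:C * u + (t + b)%:C * v) - G (w0 + x%:C * u + t%:C * v))
        s (s + a).
Proof.
move=> a0 b0; apply/eqP; rewrite -subr_eq0; apply/eqP.
rewrite -[LHS]/(E s t a b); apply: eq0_normc; apply/eqP.
rewrite eq_le normc_ge0 andbT leNgt; apply/negP; set c := normc _ => c0.
pose A n := a / 2 ^+ n; pose B n := b / 2 ^+ n.
have A0 n : 0 < A n by rewrite divr_gt0 // exprn_gt0.
have B0 n : 0 < B n by rewrite divr_gt0 // exprn_gt0.
have half (x : R) n : x / 2 ^+ n = x / 2 ^+ n.+1 + x / 2 ^+ n.+1.
  by rewrite exprS; field; rewrite ?expf_neq0.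
(* Invariant of the bisection at step [n], for the lower corner [q]. *)
pose P n (q : R * R) := c / 4 ^+ n <= normc (E q.1 q.2 (A n) (B n)).
have step (nq : nat * (R * R)) : exists q : R * R, P nq.1 nq.2 ->
    [/\ P nq.1.+1 q, nq.2.1 <= q.1, q.1 + A nq.1.+1 <= nq.2.1 + A nq.1,
        nq.2.2 <= q.2 & q.2 + B nq.1.+1 <= nq.2.2 + B nq.1].
  case: nq => n [x y] /=; rewrite /P /=.
  have eA : A n = A n.+1 + A n.+1 by exact: half.
  have eB : B n = B n.+1 + B n.+1 by exact: half.
  have := A0 n.+1; have := B0 n.+1 => Bn An.
  rewrite {1}eA {1}eB E_split // eA eB.
  rewrite [c / 4 ^+ n](_ : _ = 4 * (c / 4 ^+ n.+1)); last first.
    by rewrite [4 ^+ n.+1]exprS invfM; field; rewrite expf_neq0.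
  exact: (largest_quarter (fun x y => E x y (A n.+1) (B n.+1))).
have [f Hf] := choice step.
pose q := fix q n := if n is n'.+1 then f (n', q n') else (s, t).
have Pq n : P n (q n).
  elim: n => [|n IH]; last by case: (Hf (n, q n) IH).
  by rewrite /P /A /B /= !expr0 !divr1.
have qS n := Hf (n, q n) (Pq n).
have [ls Hs] : exists l, forall n, (q n).1 <= l <= (q n).1 + A n.
  by apply: nested_intervals => n; [exact: ltW|case: (qS n)..].
have [lt Ht] : exists l, forall n, (q n).2 <= l <= (q n).2 + B n.
  by apply: nested_intervals => n; [exact: ltW|case: (qS n)..].
have ab0 : 0 < a + b by rewrite addr_gt0.
have e0 : 0 < c / (2 * (a + b) ^+ 2) by rewrite divr_gt0 // mulr_gt0 // exprn_gt0.
have [d d0 Hd] := E_local ls lt e0.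
have [n nd] : exists n, A n + B n < d.
  have [n] : exists n, (a + b) / d < 2 ^+ n.
    exists (Num.truncn ((a + b) / d)).+1.
    apply: (lt_trans (truncnS_gt _)).
    by rewrite -natrX ltr_nat ltn_expl.
  rewrite ltr_pdivrMr // => lt2; exists n.
  by rewrite /A /B -mulrDl ltr_pdivrMr ?exprn_gt0 // mulrC.
have := le_trans (Pq n) (Hd _ _ _ _ (A0 n) (B0 n) (Hs n) (Ht n) nd).
have -> : c / (2 * (a + b) ^+ 2) * (A n + B n) ^+ 2 = c / 4 ^+ n / 2.
  rewrite /A /B -mulrDl (_ : 4 ^+ n = (2 ^+ n) ^+ 2); last first.
    by rewrite -exprM mulnC exprM; congr (_ ^+ n); ring.
  have X0 : (2 : R) ^+ n != 0 by rewrite expf_neq0.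
  by field; rewrite X0 gt_eqF.
have : 0 < c / 4 ^+ n by rewrite divr_gt0 // exprn_gt0.
by lra.
Qed.

End Goursat.

(** * The complex exponential and integrals over circles *)

Section ComplexExponential.
Variable R : realType.
Implicit Types (w z : R[i]) (t : R).

Definition cexp w : R[i] := (expR (Re w))%:C * (cos (Im w) +i* sin (Im w)).

Lemma cexpD w z : cexp (w + z) = cexp w * cexp z.
Proof.
case: w z => a b [c d]; rewrite /cexp /= expRD cosD sinD.
by apply/eqP; rewrite eq_complex /=; apply/andP; split; apply/eqP; ring.
Qed.

Lemma cexp0 : cexp 0 = 1.
Proof. by rewrite /cexp /= expR0 cos0 sin0 mul1r. Qed.

Lemma cexp_neq0 w : cexp w != 0.
Proof.
apply/eqP => w0; have := cexpD w (- w); rewrite subrr cexp0 w0 mul0r.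
by move/eqP; rewrite oner_eq0.
Qed.

Lemma cexp_circle t : cexp (t%:C * 'i%C) = cos t +i* sin t.
Proof. by rewrite /cexp /= !mul0r !mulr0 mulr1 subr0 addr0 expR0 mul1r. Qed.

Lemma cexp_pi : cexp (pi%:C * 'i%C) = cexp ((- pi)%:C * 'i%C).
Proof. by rewrite !cexp_circle cosN sinN sinpi oppr0. Qed.

(** The polar form; acos gives an argument in the upper half plane, and its
    opposite is taken in the lower one. *)
Lemma cexp_surj z : z != 0 -> exists w, z = cexp w.
Proof.
move=> z0; have nz0 := normc_gt0 z0.
case: z z0 nz0 => a b _; set r := normc _ => r0.
have r2 : r ^+ 2 = a ^+ 2 + b ^+ 2.
  by rewrite /r /= sqr_sqrtr // addr_ge0 ?sqr_ge0.
have ar : `|a| <= r by apply: (@normc_Re R (a +i* b)).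
have ar1 : -1 <= a / r <= 1 by rewrite -ler_norml normrM normfV (gtr0_norm r0) ler_pdivrMr // mul1r.
have sa : sin (acos (a / r)) = `|b| / r.
  rewrite sin_acos // expr_div_n r2 -[in RHS](gtr0_norm r0) -normf_div -sqrtr_sqr.
  congr Num.sqrt; rewrite expr_div_n r2; field.
  by rewrite -r2 expf_neq0 // gt_eqF.
have ca : cos (acos (a / r)) = a / r by rewrite acosK // in_itv.
exists (ln r +i* (if 0 <= b then acos (a / r) else - acos (a / r))).
rewrite /cexp /= lnK // ?posrE //.
have [b0|b0] := leP 0 b.
  rewrite ca sa (ger0_norm b0); apply/eqP; rewrite eq_complex /=.
  by apply/andP; split; apply/eqP; field; rewrite gt_eqF.
rewrite cosN sinN ca sa (ltr0_norm b0); apply/eqP; rewrite eq_complex /=.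
by apply/andP; split; apply/eqP; field; rewrite gt_eqF.
Qed.

Lemma is_derive_eps0 (f : R -> R) (D : R) : is_derive (0 : R) 1 f D ->
  forall e, 0 < e -> exists2 d, 0 < d & forall x, `|x| < d ->
    `|f x - f 0 - D * x| <= e * `|x|.
Proof.
move=> [df Df] e e0.
have : (h^-1 *: (((f : R^o -> R^o) \o shift 0) (h *: (1 : R^o)) - f 0)
     @[h --> (0 : R^o)^'] --> (D : R^o)) by rewrite -Df; exact: df.
move=> /derivable_epsP /(_ e e0)[d d0 Hd]; exists d => // x xd.
by have := Hd x; rewrite subr0; exact.
Qed.

(** The real and imaginary parts of [cexp z - 1 - z] are split into terms each of
    which contains one of the remainders of exp, cos and sin at 0. *)
Lemma cexp_derivable0 (e : R) : 0 < e -> exists2 d, 0 < d &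
  forall z, normc z < d -> normc (cexp z - 1 - z) <= e * normc z.
Proof.
move=> e0; have e60 : 0 < e / 8 by rewrite divr_gt0.
have e1 : 0 < Num.min (e / 8) 1 by rewrite lt_min e60 ltr01.
have [d1 d10 H1] := is_derive_eps0 (is_derive_expR 0) e1.
have [d2 d20 H2] := is_derive_eps0 (is_derive_cos 0) e60.
have [d3 d30 H3] := is_derive_eps0 (is_derive_sin 0) e60.
set d4 := Num.min (e / 16) (1 / 2).
exists (Num.min (Num.min d1 d2) (Num.min d3 d4)); first by rewrite !lt_min d10 d20 d30 !divr_gt0.
case=> x y; set n := normc _.
have xn : `|x| <= n := @normc_Re R (x +i* y).
have yn : `|y| <= n := @normc_Im R (x +i* y).
rewrite !lt_min => /andP[/andP[n1 n2] /andP[n3 /andP[n4 n5]]].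
have := H1 x (le_lt_trans xn n1); have := H2 y (le_lt_trans yn n2).
have := H3 y (le_lt_trans yn n3).
rewrite cos0 sin0 expR0 oppr0 mul0r !subr0 ?addr0 !mul1r.
set E := expR x; set c := cos y; set s := sin y => hs hc hE.
have hE' : `|E - 1| <= e / 8 /\ `|E| <= 2.
  (* The bound 2 on [E] is the purpose of the 1 in the minimum. *)
  have m1 : Num.min (e / 8) 1 <= 1 by rewrite ge_min lexx orbT.
  have k1 : `|E - 1 - x| <= `|x|.
    by apply: (le_trans hE); rewrite ler_piMl.
  have k2 : `|E - 1| <= 2 * `|x|.
    have := ler_normD (E - 1 - x) x; rewrite subrK; lra.
  have k3 := ler_normD (E - 1) 1; rewrite subrK normr1 in k3.
  by split; lra.
have {}hE : `|E - 1 - x| <= e / 8 * `|x|.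
  apply: (le_trans hE); rewrite ler_wpM2r // ge_min lexx //.
have n0 : 0 <= n := normc_ge0 _.
apply: (le_trans (normc_le _)); rewrite /cexp /= -/E -/c -/s !mul0r subr0 addr0 subr0.
have -> : E * c - 1 - x = (E - 1 - x) + E * (c - 1) by ring.
have -> : E * s - y = E * (s - y) + (E - 1) * y by ring.
case: hE' => hE1 hE2.
have := ler_normD (E - 1 - x) (E * (c - 1)); rewrite normrM => t1.
have := ler_normD (E * (s - y)) ((E - 1) * y); rewrite !normrM => t2.
have t3 : `|E| * `|c - 1| <= 2 * (e / 8 * n).
  by apply: ler_pM => //; apply: (le_trans hc); rewrite ler_pM2l.
have t4 : `|E| * `|s - y| <= 2 * (e / 8 * n).
  by apply: ler_pM => //; apply: (le_trans hs); rewrite ler_pM2l.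
have t5 : `|E - 1| * `|y| <= e / 8 * n by apply: ler_pM.
have t6 : e / 8 * `|x| <= e / 8 * n by rewrite ler_pM2l.
have en : 0 <= e * n by rewrite mulr_ge0 // ltW.
lra.
Qed.

Lemma cexp_derivable w : derivable (cexp : R[i]^o -> R[i]^o) w 1.
Proof.
apply: (@eps_derivable _ _ _ (cexp w)) => e e0.
have nw := normc_gt0 (cexp_neq0 w).
have [d d0 Hd] := cexp_derivable0 (divr_gt0 e0 nw).
exists d => // z zw; have -> : cexp z = cexp w * cexp (z - w) by rewrite -cexpD addrC subrK.
have -> : cexp w * cexp (z - w) - cexp w - cexp w * (z - w) =
  cexp w * (cexp (z - w) - 1 - (z - w)) by ring.
rewrite normcM; have := Hd _ zw; rewrite -(ler_pM2l nw) => /le_trans; apply.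
by rewrite mulrA [normc (cexp w) * _]mulrC divfK // gt_eqF.
Qed.

End ComplexExponential.

Section CircleMean.
Variable R : realType.
Implicit Types (F f : R[i] -> R[i]) (z : R[i]).

Local Notation Cstar := [set z : R[i] | z != 0].

Definition circ (t : R) : R[i] := cexp (t%:C * 'i%C).

(** Up to the factor 2 pi, the mean of [F] over the unit circle; applied to
    [F z * z ^ k] it gives the Laurent coefficient of index - k. *)
Definition circle_int F : R[i] := cint (F \o circ) (- pi) pi.

Lemma derivable_compC F g z : derivable (g : R[i]^o -> R[i]^o) z 1 ->
  derivable (F : R[i]^o -> R[i]^o) (g z) 1 ->
  derivable (F \o g : R[i]^o -> R[i]^o) z 1.
Proof.
move=> /derivable1_diffP dg /derivable1_diffP dF; apply/derivable1_diffP.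
exact: (@differentiable_comp R[i] R[i]^o R[i]^o R[i]^o g F z dg dF).
Qed.

Lemma derivable_idC z : derivable (id : R[i]^o -> R[i]^o) z 1.
Proof. exact: derivable_id. Qed.

Lemma holomorphic_dilation F z : z != 0 -> holomorphic_on Cstar F ->
  holomorphic_on Cstar (fun w => F (z * w)).
Proof.
move=> z0 hF w /= w0; apply: (@derivable_compC F (fun w => z * w)).
  apply: (@derivableM _ _ (cst z : R[i]^o -> R[i]^o) id); first exact: derivable_cst.
  exact: derivable_idC.
by apply: hF => /=; rewrite mulf_neq0.
Qed.

Lemma holomorphic_cexp F : holomorphic_on Cstar F ->
  forall w, derivable (F \o @cexp R : R[i]^o -> R[i]^o) w 1.
Proof.
move=> hF w; apply: derivable_compC; first exact: cexp_derivable.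
by apply: hF; exact: cexp_neq0.
Qed.

Lemma ccont_circ F : holomorphic_on Cstar F -> ccont (F \o circ).
Proof.
move=> hF; have := ccont_affine 0 'i%C (holomorphic_cexp hF).
by congr ccont; apply/funext => t /=; rewrite add0r.
Qed.

Lemma pi_ltN : - pi < pi :> R.
Proof. by rewrite gtrN // pi_gt0. Qed.

(** Writing [z = cexp u] and passing to the logarithmic coordinate, the circle and
    its image become two opposite edges of a parallelogram of height 2 pi, and the
    other two edges cancel by periodicity. *)
Lemma circle_int_dilation F z : z != 0 -> holomorphic_on Cstar F ->
  circle_int (fun w => F (z * w)) = circle_int F.
Proof.
move=> z0 hF; have [u ->] := cexp_surj z0.
have dG := holomorphic_cexp hF.
have pi2 : 0 < pi *+ 2 :> R by rewrite mulrn_wgt0 // pi_gt0.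
have := goursat_parallelogram u 'i%C 0 dG 0 (- pi) ltr01 pi2.
have -> : - pi + pi *+ 2 = pi :> R by rewrite mulr2n addKr.
rewrite !add0r /= !mul1r.
have -> : (fun x : R => F (cexp (0 + x%:C * u + pi%:C * 'i%C))
            - F (cexp (0 + x%:C * u + (- pi)%:C * 'i%C))) = fun=> 0.
  by apply/funext => x; rewrite !cexpD cexp_pi subrr.
have c0 : ccont (fun=> 0 : R[i]) by exact: ccont_cst.
have -> : cint (fun=> 0) 0 1 = 0 :> R[i].
  apply: etrans (etrans (cintZ 0 (@ltr01 R) c0) (mul0r _)).
  by congr cint; apply/funext => x; rewrite mul0r.
rewrite mulr0 => /eqP; rewrite mulf_eq0 => /orP[/eqP i0|].
  by move/(congr1 Im): i0 => /= /eqP; rewrite oner_eq0.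
have hz := holomorphic_dilation (cexp_neq0 u) hF.
move=> /eqP e.
apply/eqP; rewrite -subr_eq0 /circle_int -(cintB pi_ltN (ccont_circ hz) (ccont_circ hF)).
apply/eqP; rewrite -[RHS]e; congr cint; apply/funext => t /=.
rewrite /circ -cexpD; congr (F (cexp _) - F (cexp _)).
by rewrite rmorph0 mul0r add0r.
Qed.

End CircleMean.

(** * Vanishing of all Laurent coefficients *)

Section HolomorphicClosure.
Variable R : realType.
Implicit Types (F G : R[i] -> R[i]).

Local Notation Cstar := [set z : R[i] | z != 0].

Lemma holomorphic_cst (c : R[i]) : holomorphic_on Cstar (fun=> c).
Proof. by move=> z _; exact: (@derivable_cst _ R[i]^o R[i]^o). Qed.

Lemma holomorphic_id : holomorphic_on Cstar id.
Proof. by move=> z _; exact: derivable_idC. Qed.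

Lemma holomorphicM F G : holomorphic_on Cstar F -> holomorphic_on Cstar G ->
  holomorphic_on Cstar (fun z => F z * G z).
Proof.
move=> hF hG z z0.
exact: (@derivableM _ R[i]^o (F : R[i]^o -> R[i]^o) G _ _ (hF z z0) (hG z z0)).
Qed.

Lemma holomorphicD F G : holomorphic_on Cstar F -> holomorphic_on Cstar G ->
  holomorphic_on Cstar (fun z => F z + G z).
Proof.
move=> hF hG z z0.
exact: (@derivableD _ R[i]^o R[i]^o F G _ _ (hF z z0) (hG z z0)).
Qed.

Lemma holomorphic_inv : holomorphic_on Cstar (fun z => z^-1).
Proof.
move=> z z0.
exact: (@derivableV R[i] R[i]^o (id : R[i]^o -> R[i]^o) z 1 z0 (@derivable_idC R z)).
Qed.

Lemma holomorphic_prod (I : Type) (r : seq I) (P : pred I) (F : I -> R[i] -> R[i]) :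
  (forall i, P i -> holomorphic_on Cstar (F i)) ->
  holomorphic_on Cstar (fun z => \prod_(i <- r | P i) F i z).
Proof.
move=> hF; elim: r => [|i r IH].
  have -> : (fun z => \prod_(i <- [::] | P i) F i z) = (fun=> 1).
    by apply/funext => z; rewrite big_nil.
  exact: holomorphic_cst.
have [Pi|nPi] := boolP (P i).
  have -> : (fun z => \prod_(j <- i :: r | P j) F j z) =
            (fun z => F i z * \prod_(j <- r | P j) F j z).
    by apply/funext => z; rewrite big_cons Pi.
  exact: (holomorphicM (hF i Pi) IH).
have -> : (fun z => \prod_(j <- i :: r | P j) F j z) =
          (fun z => \prod_(j <- r | P j) F j z).
  by apply/funext => z; rewrite big_cons (negbTE nPi).
exact: IH.
Qed.

Lemma holomorphic_sum (I : Type) (r : seq I) (P : pred I) (F : I -> R[i] -> R[i]) :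
  (forall i, P i -> holomorphic_on Cstar (F i)) ->
  holomorphic_on Cstar (fun z => \sum_(i <- r | P i) F i z).
Proof.
move=> hF; elim: r => [|i r IH].
  have -> : (fun z => \sum_(i <- [::] | P i) F i z) = (fun=> 0).
    by apply/funext => z; rewrite big_nil.
  exact: holomorphic_cst.
have [Pi|nPi] := boolP (P i).
  have -> : (fun z => \sum_(j <- i :: r | P j) F j z) =
            (fun z => F i z + \sum_(j <- r | P j) F j z).
    by apply/funext => z; rewrite big_cons Pi.
  exact: (holomorphicD (hF i Pi) IH).
have -> : (fun z => \sum_(j <- i :: r | P j) F j z) =
          (fun z => \sum_(j <- r | P j) F j z).
  by apply/funext => z; rewrite big_cons (negbTE nPi).
exact: IH.
Qed.

Lemma holomorphicX F n : holomorphic_on Cstar F ->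
  holomorphic_on Cstar (fun z => F z ^+ n).
Proof.
move=> hF; elim: n => [|n IH].
  by have -> : (fun z => F z ^+ 0) = (fun=> 1) by []; exact: holomorphic_cst.
have -> : (fun z => F z ^+ n.+1) = (fun z => F z * F z ^+ n).
  by apply/funext => z; rewrite exprS.
exact: holomorphicM.
Qed.

Lemma holomorphic_exprz (k : int) : holomorphic_on Cstar (fun z => z ^ k).
Proof.
case: k => n; first exact: holomorphicX holomorphic_id.
have -> : (fun z : R[i] => z ^ Negz n) = (fun z => z^-1 ^+ n.+1).
  by apply/funext => z; rewrite NegzE exprVn.
exact: holomorphicX holomorphic_inv.
Qed.

End HolomorphicClosure.

Section FourierUniqueness.
Variable R : realType.

Lemma bernoulli_ineq (x : R) n : 0 <= x -> 1 + n%:R * x <= (1 + x) ^+ n.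
Proof.
move=> x0; elim: n => [|n IH]; first by rewrite mul0r addr0.
rewrite exprS; apply: (@le_trans _ _ ((1 + x) * (1 + n%:R * x))).
  rewrite mulrSr; have : 0 <= n%:R * x * x by rewrite !mulr_ge0.
  by set m := n%:R; lra.
by rewrite ler_wpM2l // addr_ge0.
Qed.

Lemma cos_le (s t : R) : 0 <= s -> s <= `|t| -> `|t| <= pi -> cos t <= cos s.
Proof.
move=> s0 st tpi.
have -> : cos t = cos `|t| by case: (ger0P t) => // _; rewrite cosN.
have [->//|neq] := eqVneq `|t| s; apply: ltW.
rewrite ltr_cos ?in_itv /= ?s0 ?normr_ge0 ?tpi ?(le_trans st) //.
by rewrite lt_neqAle eq_sym neq.
Qed.

(** The trigonometric polynomial [c + cos t], with [c = 1 - cos d], is at least 1 on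
    [-d, d], exceeds 1 by a fixed amount on [-d/2, d/2], and is bounded by 1 in absolute
    value elsewhere.  So the integral over [-d/2, d/2], where [f] is positive, grows
    without bound with the power [n], while the negative contributions stay bounded. *)
Lemma peak_kernel (f : R -> R) : continuous f -> 0 < f 0 -> exists (c : R) n,
  0 < rint (fun t => f t * (c + cos t) ^+ n) (- pi) pi.
Proof.
move=> cf f0.
have pi0 : 0 < pi :> R := pi_gt0 R.
have [d1 d10 Hd1] : exists2 d, 0 < d & forall t, `|t| < d -> f 0 / 2 <= f t.
  have f20 : 0 < f 0 / 2 by rewrite divr_gt0.
  have /cvgrPdist_lt /(_ _ f20) [d /= d0 Hd] := cf 0.
  exists d => // t td; have := Hd t; rewrite /ball_ /= sub0r normrN => /(_ td).
  by rewrite ltr_norml => /andP[h1 h2]; lra.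
(* [d] is such that [f] stays above [f 0 / 2] on [-d, d]. *)
pose d := Num.min (d1 / 2) (pi / 2).
have d0 : 0 < d by rewrite lt_min !divr_gt0.
have dd1 : d < d1.
  by apply: (@le_lt_trans _ _ (d1 / 2)); [rewrite ge_min lexx|lra].
have dpi : d < pi.
  by apply: (@le_lt_trans _ _ (pi / 2)); [rewrite ge_min lexx orbT|lra].
clearbody d.
have [K K0 HK] : exists2 K, 0 <= K & forall t, - pi <= t <= pi -> `|f t| <= K.
  have cnf : continuous (fun t => `|f t|).
    by move=> t; apply: cvg_norm; exact: cf.
  have [t _ Ht] := EVT_max (ltW (pi_ltN R)) (cont_within cnf).
  by exists `|f t| => // s; have := Ht s; rewrite in_itv.
pose eta := cos (d / 2) - cos d.
have eta0 : 0 < eta.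
  have m1 : d \in `[0, pi] by rewrite in_itv /=; apply/andP; split; lra.
  have m2 : d / 2 \in `[0, pi] by rewrite in_itv /=; apply/andP; split; lra.
  by rewrite subr_gt0 ltr_cos //; lra.
pose P t := (- cos d + 1) + cos t.
have P1 t : `|t| <= d -> 1 <= P t.
  move=> td; have := @cos_le `|t| d (normr_ge0 _).
  rewrite (gtr0_norm d0) => /(_ td (ltW dpi)).
  have -> : cos `|t| = cos t by case: (ger0P t) => // _; rewrite cosN.
  by rewrite /P; lra.
have P2 t : `|t| <= d / 2 -> 1 + eta <= P t.
  move=> td; have := @cos_le `|t| (d / 2) (normr_ge0 _).
  have d20 : 0 < d / 2 by rewrite divr_gt0.
  rewrite (gtr0_norm d20) => /(_ td).
  have -> : cos `|t| = cos t by case: (ger0P t) => // _; rewrite cosN.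
  have dp : d / 2 <= pi by lra.
  by move=> /(_ dp); rewrite /P /eta; lra.
have P3 t : d <= `|t| <= pi -> `|P t| <= 1.
  move=> /andP[dt tpi]; have h := cos_le (ltW d0) dt tpi.
  have h1 := cos_geN1 t; have h2 := cos_le1 d.
  by rewrite ler_norml /P; apply/andP; split; lra.
(* The gain on the small interval beats the bound 2 pi K for the rest of the circle. *)
have [n Hn] : exists n, 2 * pi * K < n%:R * (eta * (f 0 / 2 * d)).
  have X0 : 0 < eta * (f 0 / 2 * d) by rewrite !mulr_gt0 // invr_gt0.
  exists (Num.truncn (2 * pi * K / (eta * (f 0 / 2 * d)))).+1.
  by rewrite -ltr_pdivrMr // truncnS_gt.
exists (- cos d + 1), n.
pose g t := f t * P t ^+ n.
have cg : continuous g.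
  move=> t; apply: cvgM; first exact: cf.
  have cP : {for t, continuous P}.
    by apply: cvgD; [exact: cvg_cst|exact: continuous_cos].
  apply: (@continuous_comp _ _ _ P (fun x => x ^+ n)) => //.
  exact: exprn_continuous.
rewrite -[X in _ < rint X _ _]/g.
have l1 : - pi < - d by rewrite ltrN2.
have l2 : - d < - (d / 2) by lra.
have l3 : - (d / 2) < d / 2 by lra.
have l4 : d / 2 < d by lra.
rewrite (rint_split (b := - d) l1) //; last by lra.
rewrite (rint_split (a := - d) (b := - (d / 2)) l2) //; last by lra.
rewrite (rint_split (a := - (d / 2)) (b := d / 2) l3) //; last by lra.
rewrite (rint_split (a := d / 2) (b := d) l4) //.
have outer t : d <= `|t| <= pi -> - K <= g t <= K.
  move=> tb; rewrite -ler_norml normrM normrX -[K]mulr1; apply: ler_pM => //.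
    by apply: HK; rewrite -ler_norml; case/andP: tb.
  by rewrite exprn_ile1 // P3.
have mid t : `|t| <= d -> 0 <= g t.
  move=> td; apply: mulr_ge0; last by rewrite exprn_ge0 // (le_trans ler01) // P1.
  by apply: (le_trans _ (Hd1 t (le_lt_trans td dd1))); rewrite divr_ge0 // ltW.
have inner t : `|t| <= d / 2 -> f 0 / 2 * (1 + n%:R * eta) <= g t.
  move=> td; apply: ler_pM.
  - by rewrite divr_ge0 // ltW.
  - by rewrite addr_ge0 // mulr_ge0 // ltW.
  - by apply: Hd1; lra.
  - apply: (le_trans (bernoulli_ineq n (ltW eta0))).
    by apply: lerXn2r; rewrite ?nnegrE ?P2 //; [lra|have := P2 t td; lra].
have lower (x y m : R) : x < y -> (forall t, x <= t <= y -> m <= g t) ->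
    m * (y - x) <= rint g x y.
  move=> xy Hm.
  have [t _ Ht] := EVT_max (ltW xy) (cont_within cg).
  have gb s : x <= s <= y -> m <= g s <= g t.
    by move=> sxy; rewrite Hm //=; apply: Ht; rewrite in_itv.
  by have /andP[] := rint_bound xy cg gb.
have i1 : - K * (- d - - pi) <= rint g (- pi) (- d).
  apply: lower => // t /andP[t1 t2].
  have : d <= `|t| <= pi by rewrite ler0_norm; [apply/andP; split; lra|lra].
  by move/outer/andP => [].
have i2 : 0 * (- (d / 2) - - d) <= rint g (- d) (- (d / 2)).
  apply: lower => // t /andP[t1 t2]; apply: mid.
  by rewrite ler_norml; apply/andP; split; lra.
have i3 : f 0 / 2 * (1 + n%:R * eta) * (d / 2 - - (d / 2)) <= rint g (- (d / 2)) (d / 2).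
  by apply: lower => // t tb; apply: inner; rewrite ler_norml.
have i4 : 0 * (d - d / 2) <= rint g (d / 2) d.
  apply: lower => // t /andP[t1 t2]; apply: mid.
  by rewrite ler_norml; apply/andP; split; lra.
have i5 : - K * (pi - d) <= rint g d pi.
  apply: lower => // t /andP[t1 t2].
  have : d <= `|t| <= pi by rewrite ger0_norm; [apply/andP; split; lra|lra].
  by move/outer/andP => [].
have Kd : 0 <= K * d by rewrite mulr_ge0 // ltW.
have fd : 0 < f 0 * d by rewrite mulr_gt0.
move: Hn i1 i2 i3 i4 i5.
move: (rint _ _ _) (rint _ _ _) (rint _ _ _) (rint _ _ _) (rint _ _ _) => r1 r2 r3 r4 r5.
by move: (n%:R : R) (eta) => m e; nra.
Qed.

End FourierUniqueness.

Section LaurentUniqueness.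
Variable R : realType.

Local Notation Cstar := [set z : R[i] | z != 0].

Definition vanishing_moments (h : R -> R[i]) : Prop :=
  forall k : int, cint (fun t => h t * circ t ^ k) (- pi) pi = 0.

Lemma circ_neq0 (t : R) : circ t != 0. Proof. exact: cexp_neq0. Qed.

Lemma ccont_circX (k : int) : ccont (fun t : R => circ t ^ k).
Proof. exact: (ccont_circ (@holomorphic_exprz R k)). Qed.

Lemma cos_circ (t : R) : (cos t)%:C = 2^-1 * (circ t + (circ t)^-1).
Proof.
have -> : (circ t)^-1 = circ (- t).
  apply: (mulfI (circ_neq0 t)); rewrite divff ?circ_neq0 // /circ -cexpD.
  by rewrite -mulrDl -rmorphD subrr rmorph0 mul0r cexp0.
rewrite /circ !cexp_circle cosN sinN.
have -> : (cos t +i* sin t) + (cos t +i* - sin t) = 2 * (cos t)%:C.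
  apply/eqP; rewrite eq_complex /=; apply/andP; split; apply/eqP; ring.
by rewrite mulKf // pnatr_eq0.
Qed.

(** Multiplication by cos t = (z + 1/z) / 2 only shifts the moments. *)
Lemma vanishing_moments_mulcos (h : R -> R[i]) (c : R) : ccont h ->
  vanishing_moments h -> vanishing_moments (fun t => h t * (c + cos t)%:C).
Proof.
move=> ch hm k.
have cm j : ccont (fun t => h t * circ t ^ j) by apply: ccontM => //; exact: ccont_circX.
have cc (a : R[i]) g : ccont g -> ccont (fun t => a * g t).
  by move=> cg; apply: ccontM => //; exact: ccont_cst.
have -> : (fun t => h t * (c + cos t)%:C * circ t ^ k) =
  fun t => c%:C * (h t * circ t ^ k) +
           2^-1 * (h t * circ t ^ (k + 1) + h t * circ t ^ (k - 1)).
  apply/funext => t; have -> : (c + cos t)%:C = c%:C + (cos t)%:C by rewrite rmorphD.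
  rewrite cos_circ !expfzDr ?circ_neq0 // expr1z.
  by rewrite exprN1; ring.
rewrite cint_lin ?pi_ltN ?cintD ?pi_ltN //; last exact: ccontD.
by rewrite !hm addr0 !mulr0 addr0.
Qed.

(** If [f z] were nonzero, the real part of [h t = conj (f z) * f (z * circ t)] would
    be positive at [t = 0], and its integral against every power of a trigonometric
    polynomial would vanish, against [peak_kernel]. *)
Lemma laurent_uniqueness (f : R[i] -> R[i]) : holomorphic_on Cstar f ->
  (forall k : int, circle_int (fun z => f z * z ^ k) = 0) ->
  forall z, z != 0 -> f z = 0.
Proof.
move=> hf fm z z0; apply/eqP/negP => /negP fz0.
pose w := (f z)^*; pose h t := w * f (z * circ t).
have hh : holomorphic_on Cstar (fun y => w * f (z * y)).
  by apply: holomorphicM; [exact: holomorphic_cst|exact: holomorphic_dilation].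
have ch : ccont h by exact: (ccont_circ hh).
have hm : vanishing_moments h.
  move=> k; have hfk := holomorphicM hf (@holomorphic_exprz R k).
  have := circle_int_dilation z0 hfk; rewrite fm /circle_int.
  have -> : (fun y => f (z * y) * (z * y) ^ k) \o (@circ R) =
            fun t => z ^ k * (f (z * circ t) * circ t ^ k).
    by apply/funext => t /=; rewrite expfzMl; ring.
  have cfk : ccont (fun t => f (z * circ t) * circ t ^ k).
    apply: ccontM; last exact: ccont_circX.
    exact: (ccont_circ (holomorphic_dilation z0 hf)).
  rewrite cintZ ?pi_ltN // => /eqP.
  rewrite mulf_eq0 expfz_eq0 (negbTE z0) andbF /= => /eqP e.
  have -> : (fun t => h t * circ t ^ k) = fun t => w * (f (z * circ t) * circ t ^ k).
    by apply/funext => t; rewrite /h mulrA.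
  by rewrite cintZ ?pi_ltN // e mulr0.
have ch0 : continuous (Re \o h) by case: ch.
have h0 : 0 < (Re \o h) 0.
  rewrite /h /= /circ mul0r cexp0 mulr1 /w.
  have : 0 < normc (f z) ^+ 2 by rewrite exprn_gt0 // normc_gt0.
  case: (f z) => a b /=; rewrite sqr_sqrtr ?addr_ge0 ?sqr_ge0 //.
  by rewrite !expr2; lra.
have [c [n]] := peak_kernel ch0 h0.
have [cn mn] : ccont (fun t => h t * ((c + cos t) ^+ n)%:C) /\
   vanishing_moments (fun t => h t * ((c + cos t) ^+ n)%:C).
  elim: n => [|n [IHc IHm]].
    have -> : (fun t => h t * ((c + cos t) ^+ 0)%:C) = h => //.
    by apply/funext => t; rewrite expr0 mulr1.
  have -> : (fun t => h t * ((c + cos t) ^+ n.+1)%:C) =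
            (fun t => h t * ((c + cos t) ^+ n)%:C * (c + cos t)%:C).
    by apply/funext => t; rewrite exprSr rmorphM mulrA.
  split; last exact: vanishing_moments_mulcos.
  apply: ccontM => //; split=> t.
    by apply: cvgD; [exact: cvg_cst|exact: continuous_cos].
  exact: cvg_cst.
have := congr1 (fun z : R[i] => Re z) (mn 0); rewrite /cint /= => e.
suff -> : (fun t => (Re \o h) t * (c + cos t) ^+ n) =
   (Re \o (fun t => h t * ((c + cos t) ^+ n)%:C * circ t ^ 0)) by rewrite e ltxx.
apply/funext => t /=; rewrite expr0z mulr1; case: (h t) => a b /=; ring.
Qed.

End LaurentUniqueness.

(** * The infinite product defining theta *)

Section GeometricConvergence.
Variable R : realType.

Lemma cvg_geometric_increments (u : nat -> R) (K q : R) : 0 <= K -> 0 <= q -> q < 1 ->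
  (forall n, `|u n.+1 - u n| <= K * q ^+ n) -> cvgn u.
Proof.
move=> K0 q0 q1 Hu.
have -> : u = fun n => u 0%N + series (fun k => u k.+1 - u k) n.
  by apply/funext => n; rewrite /series /= telescope_sumr // addrC subrK.
apply: is_cvgD; first exact: is_cvg_cst.
apply: normed_cvg; apply: (@series_le_cvg _ _ (geometric K q)) => [n|n|n|].
- exact: normr_ge0.
- by rewrite /= mulr_ge0 // exprn_ge0.
- exact: Hu.
- by apply: is_cvg_geometric_series; rewrite ger0_norm.
Qed.

(** Convergence is obtained coordinatewise from the completeness of [R]. *)
Lemma cvgC_geometric_increments (u : nat -> R[i]) (K q : R) :
  0 <= K -> 0 <= q -> q < 1 ->
  (forall n, normc (u n.+1 - u n) <= K * q ^+ n) ->
  exists l : R[i], u n @[n --> \oo] --> (l : R[i]^o).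
Proof.
move=> K0 q0 q1 Hu.
have /cvg_ex[a Ha] : cvgn (Re \o u : nat -> R).
  apply: (cvg_geometric_increments K0 q0 q1) => n; apply: le_trans (Hu n).
  by have := normc_Re (u n.+1 - u n); rewrite /=; case: (u n.+1) (u n) => [? ?] [].
have /cvg_ex[b Hb] : cvgn (Im \o u : nat -> R).
  apply: (cvg_geometric_increments K0 q0 q1) => n; apply: le_trans (Hu n).
  by have := normc_Im (u n.+1 - u n); rewrite /=; case: (u n.+1) (u n) => [? ?] [].
exists (a +i* b).
apply/(@cvgrPdist_le R[i] R[i]^o nat \oo _ u (a +i* b)) => _ /pos_complex[e e0 ->].
have e2 : 0 < e / 2 by rewrite divr_gt0.
move/cvgrPdist_le: Ha => /(_ _ e2) Ha; move/cvgrPdist_le: Hb => /(_ _ e2) Hb.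
near=> n; rewrite normcE lecR; apply: (le_trans (normc_le _)).
have h1 : `|a - Re (u n)| <= e / 2 by near: n.
have h2 : `|b - Im (u n)| <= e / 2 by near: n.
by move: h1 h2; case: (u n) => x y /=; lra.
Unshelve. all: by end_near.
Qed.

Lemma cvg_normc_le (u : nat -> R[i]) (l : R[i]) (K : R) :
  u n @[n --> \oo] --> (l : R[i]^o) -> (forall n, normc (u n) <= K) -> normc l <= K.
Proof.
move=> ul uK; apply/ler_addgt0Pr => e e0.
have e0' : 0 < e%:C by rewrite ltcR.
move/(@cvgrPdist_le R[i] R[i]^o nat \oo _ u l): ul => /(_ _ e0') ul.
have [n] : exists n, `|l - u n| <= e%:C by apply: filter_ex ul.
rewrite normcE lecR => h.
have := normcD (l - u n) (u n); rewrite subrK; have := uK n; lra.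
Qed.

Lemma cvgCB (u v : nat -> R[i]) (a b : R[i]) :
  u n @[n --> \oo] --> (a : R[i]^o) -> v n @[n --> \oo] --> (b : R[i]^o) ->
  (u n - v n) @[n --> \oo] --> (a - b : R[i]^o).
Proof. by move=> ua vb; exact: (@cvgB R[i] R[i]^o nat \oo _ u v a b ua vb). Qed.

Lemma expr_lt_eps (q e : R) : 0 <= q -> q < 1 -> 0 < e -> exists n, q ^+ n < e.
Proof.
move=> q0 q1 e0; have /cvgrPdist_lt /(_ _ e0) h : q ^+ n @[n --> \oo] --> 0.
  by apply: cvg_expr; rewrite ger0_norm.
have [n] : exists n, `|0 - q ^+ n| < e by apply: filter_ex h.
by rewrite sub0r normrN ger0_norm ?exprn_ge0 // => ?; exists n.
Qed.

End GeometricConvergence.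

Section Pochhammer.
Variables (R : realType) (p : R[i]).
Hypothesis p_lt1 : normc p < 1.

Let q := normc p.
Let q0 : 0 <= q. Proof. exact: normc_ge0. Qed.
Let q1 : q < 1. Proof. exact: p_lt1. Qed.

Let PN N (a : R[i]) : R[i] := \prod_(j < N) (1 - a * p ^+ j).
Let S N : R := \sum_(j < N) q ^+ j.
Let M A N : R := \prod_(j < N) (1 + A * q ^+ j).
Let Sb : R := (1 - q)^-1.
Let Mb (A : R) : R := expR (A * Sb).

(** The derivative at [a] of the [N]-th partial product, by the product rule. *)
Fixpoint pochhammer_deriv (a : R[i]) N : R[i] := if N is N'.+1 then
  pochhammer_deriv a N' * (1 - a * p ^+ N') - PN N' a * p ^+ N' else 0.
Let D := pochhammer_deriv.

Let normcX n : normc (p ^+ n) = q ^+ n.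
Proof. by elim: n => [|n IH]; rewrite ?expr0 ?normc1 // !exprS normcM IH. Qed.

Let PNS N a : PN N.+1 a = PN N a * (1 - a * p ^+ N).
Proof. by rewrite /PN big_ord_recr. Qed.
Let SS N : S N.+1 = S N + q ^+ N. Proof. by rewrite /S big_ord_recr. Qed.
Let MS A N : M A N.+1 = M A N * (1 + A * q ^+ N).
Proof. by rewrite /M big_ord_recr. Qed.
Let PN0 a : PN 0 a = 1. Proof. by rewrite /PN big_ord0. Qed.
Let S0 : S 0 = 0. Proof. by rewrite /S big_ord0. Qed.
Let M0 A : M A 0 = 1. Proof. by rewrite /M big_ord0. Qed.

Let qn0 n : 0 <= q ^+ n. Proof. by rewrite exprn_ge0. Qed.

Let S_ge0 N : 0 <= S N. Proof. by apply: sumr_ge0. Qed.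

Let Sb0 : 0 < Sb. Proof. by rewrite invr_gt0 subr_gt0. Qed.

Let S_le N : S N <= Sb.
Proof.
rewrite -[Sb]mul1r ler_pdivlMr ?subr_gt0 //.
have -> : S N * (1 - q) = 1 - q ^+ N.
  elim: N => [|N IH]; first by rewrite S0 mul0r expr0 subrr.
  by rewrite SS mulrDl IH exprS; ring.
by rewrite gerBl.
Qed.

Let M_ge1 A N : 0 <= A -> 1 <= M A N.
Proof.
move=> A0; elim: N => [|N IH]; first by rewrite M0.
by rewrite MS -[X in X <= _]mulr1 ler_pM // lerDl mulr_ge0.
Qed.

Let M_le A N : 0 <= A -> M A N <= Mb A.
Proof.
move=> A0; apply: (@le_trans _ _ (expR (A * S N))); last first.
  by rewrite ler_expR ler_wpM2l.
elim: N => [|N IH]; first by rewrite M0 S0 mulr0 expR0.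
rewrite MS SS (mulrDr A) expRD; apply: ler_pM => //.
- by apply: (le_trans ler01); exact: M_ge1.
- by rewrite addr_ge0 // mulr_ge0.
- exact: expR_ge1Dx.
Qed.

Let factor_le A N a : normc a <= A -> normc (1 - a * p ^+ N) <= 1 + A * q ^+ N.
Proof.
move=> aA; apply: (le_trans (normcD _ _)); rewrite normc1 normcN normcM normcX.
by rewrite lerD2l ler_wpM2r.
Qed.

Let PN_le A N a : normc a <= A -> normc (PN N a) <= M A N.
Proof.
move=> aA; elim: N => [|N IH]; first by rewrite PN0 M0 normc1.
by rewrite PNS MS normcM; apply: ler_pM; rewrite ?normc_ge0 // factor_le.
Qed.

Section Bounds.
Variables (A : R) (a b : R[i]).
Hypotheses (aA : normc a <= A) (bA : normc b <= A).

Let A0 : 0 <= A. Proof. exact: le_trans (normc_ge0 a) aA. Qed.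
Let Mg N : 0 <= M A N. Proof. by apply: (le_trans ler01); exact: M_ge1. Qed.
Let AqN N : 0 <= A * q ^+ N. Proof. by rewrite mulr_ge0. Qed.

Let PN_leb N : normc (PN N b) <= M A N. Proof. exact: PN_le. Qed.

Let PN_lip N : normc (PN N a - PN N b) <= normc (a - b) * (S N * M A N).
Proof.
have h := normc_ge0 (a - b).
elim: N => [|N IH]; first by rewrite !PN0 subrr normc0 S0 mul0r mulr0.
have -> : PN N.+1 a - PN N.+1 b =
  (PN N a - PN N b) * (1 - a * p ^+ N) - PN N b * ((a - b) * p ^+ N).
  by rewrite !PNS; ring.
apply: (le_trans (normcD _ _)); rewrite normcN !normcM normcX.
apply: (@le_trans _ _ (normc (a - b) * (S N * M A N) * (1 + A * q ^+ N)
                       + M A N * (normc (a - b) * q ^+ N))).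
  apply: lerD; apply: ler_pM => //; rewrite ?normc_ge0 ?factor_le //.
  by rewrite mulr_ge0.
rewrite SS MS.
have -> : normc (a - b) * ((S N + q ^+ N) * (M A N * (1 + A * q ^+ N))) =
  normc (a - b) * (S N * M A N) * (1 + A * q ^+ N) + M A N * (normc (a - b) * q ^+ N)
  + normc (a - b) * (M A N * (q ^+ N * (A * q ^+ N))) by ring.
by rewrite lerDl !mulr_ge0.
Qed.

Let D_le N : normc (D b N) <= S N * M A N.
Proof.
elim: N => [|N IH]; first by rewrite normc0 S0 mul0r.
apply: (le_trans (normcD _ _)); rewrite normcN !normcM normcX SS MS.
apply: (@le_trans _ _ (S N * M A N * (1 + A * q ^+ N) + M A N * q ^+ N)).
  apply: lerD; apply: ler_pM => //; rewrite ?normc_ge0 ?factor_le //.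
have -> : (S N + q ^+ N) * (M A N * (1 + A * q ^+ N)) =
  S N * M A N * (1 + A * q ^+ N) + M A N * q ^+ N + M A N * (q ^+ N * (A * q ^+ N)).
  by ring.
by rewrite lerDl !mulr_ge0.
Qed.

Let PN_taylor N : normc (PN N a - PN N b - D b N * (a - b)) <=
  normc (a - b) ^+ 2 * (S N ^+ 2 * M A N).
Proof.
have h := normc_ge0 (a - b).
elim: N => [|N IH].
  by rewrite !PN0 subrr mul0r subr0 normc0 !mulr_ge0 ?sqr_ge0 // exprn_ge0.
have -> : PN N.+1 a - PN N.+1 b - D b N.+1 * (a - b) =
  (PN N a - PN N b - D b N * (a - b)) * (1 - b * p ^+ N)
  - (PN N a - PN N b) * ((a - b) * p ^+ N).
  by rewrite !PNS /=; ring.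
apply: (le_trans (normcD _ _)); rewrite normcN !normcM normcX.
apply: (@le_trans _ _ (normc (a - b) ^+ 2 * (S N ^+ 2 * M A N) * (1 + A * q ^+ N)
                       + normc (a - b) * (S N * M A N) * (normc (a - b) * q ^+ N))).
  apply: lerD; apply: ler_pM => //; rewrite ?normc_ge0 ?factor_le //.
  by rewrite mulr_ge0.
rewrite SS MS.
have -> : normc (a - b) ^+ 2 * ((S N + q ^+ N) ^+ 2 * (M A N * (1 + A * q ^+ N))) =
  normc (a - b) ^+ 2 * (S N ^+ 2 * M A N) * (1 + A * q ^+ N)
  + normc (a - b) * (S N * M A N) * (normc (a - b) * q ^+ N)
  + normc (a - b) ^+ 2 * M A N * (S N * q ^+ N * (1 + 2 * (A * q ^+ N))
      + q ^+ N * q ^+ N * (1 + A * q ^+ N)) by ring.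
rewrite lerDl !mulr_ge0 ?exprn_ge0 // addr_ge0 //.
all: by rewrite !mulr_ge0 // addr_ge0 // mulr_ge0.
Qed.

(** These bounds on the partial products, their derivatives and their first and
    second order Taylor remainders do not depend on [N].  They survive in the limit
    and give the differentiability of the infinite product. *)
Lemma pochhammer_bounds N :
  [/\ normc (PN N a) <= Mb A, normc (D b N) <= Sb * Mb A,
      normc (PN N a - PN N b) <= normc (a - b) * (Sb * Mb A) &
      normc (PN N a - PN N b - D b N * (a - b)) <= normc (a - b) ^+ 2 * (Sb ^+ 2 * Mb A)].
Proof.
have h := normc_ge0 (a - b).
have SM : S N * M A N <= Sb * Mb A by apply: ler_pM => //; exact: M_le.
split.
- by apply: (le_trans (PN_le N aA)); exact: M_le.
- exact: (le_trans (D_le N)).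
- by apply: (le_trans (PN_lip N)); rewrite ler_wpM2l.
- apply: (le_trans (PN_taylor N)); rewrite ler_wpM2l ?exprn_ge0 //.
  by apply: ler_pM; rewrite ?exprn_ge0 ?M_le // lerXn2r // nnegrE // ltW.
Qed.

End Bounds.

Lemma cvg_pochhammer a : PN N a @[N --> \oo] --> (pochhammer_inf p a : R[i]^o).
Proof.
have Mb0 : 0 <= Mb (normc a) by rewrite expR_ge0.
have [l Hl] : exists l : R[i], PN N a @[N --> \oo] --> (l : R[i]^o).
  apply: (@cvgC_geometric_increments _ _ (Mb (normc a) * normc a) q) => //.
    by rewrite mulr_ge0 // normc_ge0.
  move=> n; have -> : PN n.+1 a - PN n a = - (PN n a * (a * p ^+ n)).
    by rewrite PNS; ring.
  rewrite normcN !normcM normcX mulrA ler_wpM2r // ler_wpM2r ?normc_ge0 //.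
  by have [] := pochhammer_bounds (lexx (normc a)) (lexx (normc a)) n.
suff -> : pochhammer_inf p a = l by exact: Hl.
by apply: (@cvg_lim R[i]^o); [exact: norm_hausdorff|exact: Hl].
Qed.

Lemma pochhammer_eq a (l : R[i]) :
  PN N a @[N --> \oo] --> (l : R[i]^o) -> pochhammer_inf p a = l.
Proof. by move=> Hl; apply: (@cvg_lim R[i]^o); [exact: norm_hausdorff|exact: Hl]. Qed.

Lemma pochhammer_rec a : pochhammer_inf p a = (1 - a) * pochhammer_inf p (p * a).
Proof.
apply: pochhammer_eq; rewrite -(cvg_shiftS (PN ^~ a : nat -> R[i]^o)) /=.
have -> : (fun N => PN N.+1 a) = fun N => (1 - a) * PN N (p * a).
  apply/funext => N; rewrite /PN big_ord_recl expr0 mulr1; congr (_ * _).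
  by apply: eq_bigr => i _; rewrite lift0 exprS mulrA (mulrC a).
by apply: cvgM; [exact: cvg_cst|exact: cvg_pochhammer].
Qed.

Lemma pochhammer_derivable b :
  derivable (pochhammer_inf p : R[i]^o -> R[i]^o) b 1.
Proof.
set A := normc b + 1; have bA : normc b <= A by rewrite lerDl.
have K0 : 0 <= Sb * Mb A by rewrite mulr_ge0 ?expR_ge0 // ltW.
have K20 : 0 <= Sb ^+ 2 * Mb A by rewrite mulr_ge0 ?expR_ge0 // exprn_ge0 // ltW.
have [d Hd] : exists l : R[i], D b N @[N --> \oo] --> (l : R[i]^o).
  apply: (@cvgC_geometric_increments _ _ (Sb * Mb A * normc b + Mb A) q) => //.
    by rewrite addr_ge0 ?expR_ge0 // mulr_ge0 // normc_ge0.
  move=> n; have -> : D b n.+1 - D b n = - (D b n * b * p ^+ n + PN n b * p ^+ n).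
    by rewrite /=; ring.
  rewrite normcN; apply: (le_trans (normcD _ _)); rewrite !normcM normcX -mulrDl.
  have [h1 h2 _ _] := pochhammer_bounds bA bA n.
  by rewrite ler_wpM2r // lerD // ler_wpM2r // normc_ge0.
apply: (@eps_derivable _ _ _ d) => e e0.
have K1 : 0 < Sb ^+ 2 * Mb A + 1 by rewrite ltr_wpDl.
exists (Num.min 1 (e / (Sb ^+ 2 * Mb A + 1))); first by rewrite lt_min ltr01 divr_gt0.
move=> a; rewrite lt_min => /andP[ab1 abe].
have aA : normc a <= A.
  have := normcD (a - b) b; rewrite subrK /A; lra.
have h : normc (pochhammer_inf p a - pochhammer_inf p b - d * (a - b)) <=
    normc (a - b) ^+ 2 * (Sb ^+ 2 * Mb A).
  apply: (@cvg_normc_le _ (fun N => PN N a - PN N b - D b N * (a - b))).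
    apply: cvgCB; first by apply: cvgCB; exact: cvg_pochhammer.
    by apply: cvgM; [exact: Hd|exact: cvg_cst].
  by move=> n; have [] := pochhammer_bounds aA bA n.
apply: (le_trans h); rewrite expr2 -mulrA mulrC ler_wpM2r ?normc_ge0 //.
rewrite ltr_pdivlMr // in abe; apply: le_trans (ltW abe).
by rewrite ler_wpM2l ?normc_ge0 // lerDl.
Qed.

(** Only finitely many factors are far from 1: the product of the others is the value of
    the infinite product at a point close to 0, where it is close to 1. *)
Lemma pochhammer_zero a : pochhammer_inf p a = 0 -> exists j, a * p ^+ j = 1.
Proof.
move=> Ea.
have EN N : pochhammer_inf p a = PN N a * pochhammer_inf p (p ^+ N * a).
  elim: N => [|N IH]; first by rewrite PN0 mul1r expr0 mul1r.
  rewrite PNS IH pochhammer_rec [p ^+ N * a]mulrC mulrA; congr (_ * pochhammer_inf p _).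
  by rewrite exprS; ring.
have n0 : normc (0 : R[i]) <= 1 by rewrite normc0.
have small z : normc z <= 1 -> normc (pochhammer_inf p z - 1) <= normc z * (Sb * Mb 1).
  move=> z1; apply: (@cvg_normc_le _ (fun N => PN N z - 1)).
    by apply: cvgCB; [exact: cvg_pochhammer|exact: (@cvg_cst R[i]^o)].
  move=> n; have [_ _ h _] := pochhammer_bounds z1 n0 n; move: h.
  have -> : PN n 0 = 1 by rewrite /PN big1 // => i _; rewrite mul0r subr0.
  by rewrite subr0.
have K0 : 0 < Sb * Mb 1 by rewrite mulr_gt0 ?expR_gt0.
have d0 : 0 < ((normc a + 1) * (Sb * Mb 1 + 1))^-1.
  by rewrite invr_gt0 mulr_gt0 ?ltr_wpDl ?normc_ge0 // ltW.
have [N HN] := expr_lt_eps q0 q1 d0.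
have na := normc_ge0 a.
have hN : normc (p ^+ N * a) * (Sb * Mb 1 + 1) < 1.
  move: HN; rewrite -[X in _ < X]mul1r ltr_pdivlMr ?mulr_gt0 ?ltr_wpDl // ?ltW // normcM normcX.
  have := qn0 N; move: (q ^+ N) (Sb * Mb 1) K0 => x y y0 x0; nra.
have nz := normc_ge0 (p ^+ N * a).
have nz1 : normc (p ^+ N * a) <= 1 by nra.
have EpN : pochhammer_inf p (p ^+ N * a) != 0.
  apply/eqP => E0; have := small _ nz1; rewrite E0 sub0r normcN normc1; nra.
move: (EN N); rewrite Ea => /esym/eqP; rewrite mulf_eq0 (negbTE EpN) orbF.
by move=> /prodf_eq0[j _]; rewrite subr_eq0 => /eqP e; exists j.
Qed.

End Pochhammer.

(** * The theta function *)

Section Theta.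
Variables (R : realType) (p : R[i]).
Hypotheses (p_neq0 : p != 0) (p_lt1 : normc p < 1).
Implicit Types (x a : R[i]).

Local Notation Cstar := [set z : R[i] | z != 0].

Lemma thetaV x : x != 0 -> theta p x^-1 = theta p (p * x).
Proof.
move=> x0; rewrite /theta invrK [in RHS]invfM mulrA divff // mul1r.
by rewrite mulrC.
Qed.

(** The first factor of one infinite product moves to the other one. *)
Lemma theta_p x : x != 0 -> theta p (p * x) = - x^-1 * theta p x.
Proof.
move=> x0; rewrite -thetaV // /theta invrK.
rewrite (pochhammer_rec p_lt1 x^-1) (pochhammer_rec p_lt1 x).
have -> : 1 - x^-1 = - x^-1 * (1 - x) by rewrite mulrBr mulr1 mulNr mulVf // opprK addrC.
by ring.
Qed.

Lemma theta_V x : x != 0 -> theta p x^-1 = - x^-1 * theta p x.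
Proof. by move=> x0; rewrite thetaV // theta_p. Qed.

Lemma theta1 : theta p 1 = 0.
Proof. by rewrite /theta (pochhammer_rec p_lt1) subrr !mul0r. Qed.

Lemma theta_holomorphic : holomorphic_on Cstar (theta p).
Proof.
have hE : holomorphic_on Cstar (pochhammer_inf p).
  by move=> z _; exact: pochhammer_derivable.
have hV : holomorphic_on Cstar (fun z => pochhammer_inf p (p / z)).
  move=> z z0.
  have dV : derivable ((fun y => p * y^-1) : R[i]^o -> R[i]^o) z 1.
    exact: (holomorphicM (@holomorphic_cst R p) (@holomorphic_inv R) z0).
  have dE := @pochhammer_derivable _ _ p_lt1 (p * z^-1).
  exact: (@derivable_compC _ (pochhammer_inf p) (fun y => p * y^-1) z dV dE).
exact: (holomorphicM hE hV).
Qed.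

Lemma theta_zero x : x != 0 -> theta p x = 0 -> exists k : int, x = p ^ k.
Proof.
move=> x0 /eqP; rewrite /theta mulf_eq0 => /orP[] /eqP/(pochhammer_zero p_lt1)[j hj].
  exists (- j%:Z); rewrite -invr_expz; apply/eqP.
  by rewrite -[_ ^ j]/(p ^+ j) -[X in X == _](mulfK (expf_neq0 j p_neq0)) hj mul1r.
exists j.+1; rewrite -[RHS]/(p ^+ j.+1) exprS.
by apply/eqP; rewrite -subr_eq0; apply/eqP; rewrite -[X in X - _]mulr1 -hj; field.
Qed.

End Theta.

(** * Theta functions with too many zeros *)

Section CircleLinear.
Variable R : realType.
Local Notation Cstar := [set z : R[i] | z != 0].

Lemma eq_circle_int (F G : R[i] -> R[i]) :
  (forall z, z != 0 -> F z = G z) -> circle_int F = circle_int G.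
Proof.
move=> FG; rewrite /circle_int; congr cint; apply/funext => t /=.
exact/FG/circ_neq0.
Qed.

Lemma circle_intZ (c : R[i]) (F : R[i] -> R[i]) : holomorphic_on Cstar F ->
  circle_int (fun z => c * F z) = c * circle_int F.
Proof. by move=> hF; exact: (cintZ c (pi_ltN R) (ccont_circ hF)). Qed.

Lemma circle_intD (F G : R[i] -> R[i]) : holomorphic_on Cstar F -> holomorphic_on Cstar G ->
  circle_int (fun z => F z + G z) = circle_int F + circle_int G.
Proof.
by move=> hF hG; exact: (cintD (pi_ltN R) (ccont_circ hF) (ccont_circ hG)).
Qed.

Lemma circle_int_lincomb (I : Type) (r : seq I) (v : I -> R[i]) (g : I -> R[i] -> R[i]) :
  (forall i, holomorphic_on Cstar (g i)) ->
  circle_int (fun z => \sum_(i <- r) v i * g i z) = \sum_(i <- r) v i * circle_int (g i).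
Proof.
move=> hg.
have hv i : holomorphic_on Cstar (fun z => v i * g i z).
  exact: (holomorphicM (@holomorphic_cst R (v i)) (hg i)).
elim: r => [|i r IH].
  rewrite big_nil.
  apply: etrans (etrans (circle_intZ 0 (@holomorphic_cst R 1)) (mul0r _)).
  apply: eq_circle_int => z _.
  by rewrite big_nil mul0r.
rewrite big_cons -IH -circle_intZ // -circle_intD //.
  by apply: eq_circle_int => z _; rewrite big_cons.
by apply: holomorphic_sum => j _; exact: hv.
Qed.

End CircleLinear.

Section ThetaFunctions.
Variables (R : realType) (p : R[i]).
Hypotheses (p_neq0 : p != 0) (p_lt1 : normc p < 1).

Local Notation Cstar := [set z : R[i] | z != 0].

Lemma A_theta_lincomb (I : finType) m s (v : I -> R[i]) (g : I -> R[i] -> R[i]) :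
  (0 < m)%N -> s != 0 -> (forall i, A_theta_function p m s (g i)) ->
  A_theta_function p m s (fun z => \sum_i v i * g i z).
Proof.
move=> m0 s0 hg; split=> //.
  apply: holomorphic_sum => i _.
  have [_ _ hgi _] := hg i.
  exact: (holomorphicM (@holomorphic_cst R (v i)) hgi).
move=> x x0; rewrite mulr_sumr; apply: eq_bigr => i _.
by have [_ _ _ ->] := hg i => //; rewrite mulrCA.
Qed.

(** Each factor contributes 1 to the degree and [c i] to the norm. *)
Lemma A_theta_prod m (c : 'I_m -> R[i]) : (0 < m)%N -> (forall i, c i != 0) ->
  A_theta_function p m (\prod_i c i) (fun z => \prod_i theta p (c i * z)).
Proof.
move=> m0 c0; split=> //.
- by apply/prodf_neq0 => i _.
- apply: holomorphic_prod => i _; apply: holomorphic_dilation => //.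
  exact: theta_holomorphic.
- move=> x x0.
  have -> : (-1) ^+ m / ((\prod_i c i) * x ^+ m) = \prod_(i < m) - (c i * x)^-1.
    rewrite [RHS](eq_bigr (fun i => -1 * ((c i)^-1 * x^-1))); last first.
      by move=> i _; rewrite invfM mulN1r.
    by rewrite !big_split /= !prodr_const card_ord prodfV exprVn invfM.
  rewrite -big_split /=; apply: eq_bigr => i _.
  by rewrite mulrCA theta_p // mulf_neq0.
Qed.

(** Compare the circle integrals over the unit circle and over its image under
    multiplication by [p]. *)
Lemma laurent_coef_rec m s f (k : int) : A_theta_function p m s f ->
  circle_int (fun z => f z * z ^ k) =
  (-1) ^+ m / s * p ^ k * circle_int (fun z => f z * z ^ (k - m%:Z)).
Proof.
move=> [m0 s0 hf qf]; have hk j := holomorphicM hf (@holomorphic_exprz R j).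
apply: (etrans (esym (circle_int_dilation p_neq0 (hk k)))).
apply: (etrans _ (circle_intZ ((-1) ^+ m / s * p ^ k) (hk (k - m%:Z)))).
apply: eq_circle_int => z z0; rewrite qf // expfzMl expfzDr // -invr_expz.
by rewrite -[z ^ m]/(z ^+ m) invfM; ring.
Qed.

(** The recurrence propagates the vanishing from the exponents 0, ..., m - 1 to all
    integers, by Euclidean division of the exponent by [m]. *)
Lemma A_theta_laurent0 m s f : A_theta_function p m s f ->
  (forall j : 'I_m, circle_int (fun z => f z * z ^+ j) = 0) ->
  forall z, z != 0 -> f z = 0.
Proof.
move=> hf c0; have [m0 s0 holf _] := hf.
have k0 : (-1) ^+ m / s != 0 by rewrite mulf_neq0 ?signr_eq0 ?invr_eq0.
apply: laurent_uniqueness => // k.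
rewrite (divz_eq k m%:Z).
have : 0 <= (k %% m%:Z)%Z by apply: modz_ge0; rewrite eqz_nat -lt0n.
have : (k %% m%:Z)%Z < m%:Z by rewrite ltz_pmod.
case: (k %% m%:Z)%Z => // j; rewrite ltz_nat => jm _.
have cj : circle_int (fun z => f z * z ^ j%:Z) = 0 by exact: (c0 (Ordinal jm)).
case: (k %/ m%:Z)%Z => n.
  elim: n => [|n IH]; first by rewrite mul0r add0r.
  rewrite (laurent_coef_rec _ hf).
  have -> : n.+1%:Z * m%:Z + j%:Z - m%:Z = n%:Z * m%:Z + j%:Z by rewrite -addn1 PoszD; ring.
  by rewrite IH mulr0.
rewrite NegzE; elim: n.+1 => [|i IH]; first by rewrite oppr0 mul0r add0r.
have := laurent_coef_rec (- i%:Z * m%:Z + j%:Z) hf; rewrite IH.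
have -> : - i%:Z * m%:Z + j%:Z - m%:Z = - i.+1%:Z * m%:Z + j%:Z by rewrite -addn1 PoszD; ring.
move=> /esym/eqP; rewrite mulf_eq0 mulf_eq0 (negbTE k0) expfz_eq0 (negbTE p_neq0) andbF /=.
by move/eqP.
Qed.

Section Interpolation.
Variables (m : nat) (s : R[i]) (b : 'I_m -> R[i]).
Hypotheses (s_neq0 : s != 0) (b_neq0 : forall i, b i != 0).
Hypothesis b_distinct : forall i k, i != k -> theta p (b i / b k) != 0.
Hypothesis b_generic : theta p (s * \prod_i b i) != 0.

Let zeros (i k : 'I_m) : R[i] := if k == i then s * \prod_(l | l != i) b l else (b k)^-1.
(** A theta function of degree [m] and norm [s] has the product of its zeros
    prescribed by [s]; this one has the zeros [b k] for [k != i] and the remaining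
    zero forced by [s]. *)
Definition lagrange_theta (i : 'I_m) (z : R[i]) : R[i] := \prod_k theta p (zeros i k * z).

Let zeros_neq0 i k : zeros i k != 0.
Proof.
rewrite /zeros; case: ifP => _; last by rewrite invr_eq0.
by apply: mulf_neq0 => //; apply/prodf_neq0.
Qed.

Lemma lagrange_thetaP i : A_theta_function p m s (lagrange_theta i).
Proof.
have m0 : (0 < m)%N by case: i => j /(leq_ltn_trans (leq0n j)).
have -> : s = \prod_k zeros i k.
  rewrite (bigD1 i) //= {1}/zeros eqxx.
  rewrite [X in _ * X](eq_bigr (fun k => (b k)^-1)); last first.
    by move=> k ki; rewrite /zeros (negbTE ki).
  by rewrite prodfV mulfK //; apply/prodf_neq0.
exact: A_theta_prod.
Qed.

Lemma lagrange_theta_off i k : i != k -> lagrange_theta i (b k) = 0.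
Proof.
move=> ik; rewrite /lagrange_theta (bigD1 k) //= /zeros eq_sym (negbTE ik).
by rewrite mulVf // theta1 // mul0r.
Qed.

Lemma lagrange_theta_diag i : lagrange_theta i (b i) != 0.
Proof.
rewrite /lagrange_theta; apply/prodf_neq0 => k _; rewrite /zeros.
case: (eqVneq k i) => [_|ki]; last by rewrite mulrC b_distinct // eq_sym.
by move: b_generic; rewrite (bigD1 i) //= mulrCA mulrC.
Qed.

(** The m + 1 functions consisting of [f] and the interpolating functions have
    linearly dependent vectors of integrals against z^0, ..., z^(m - 1), and these
    integrals determine a theta function; so they satisfy a linear relation.
    Evaluating it at the nodes shows that only [f] occurs in it. *)
Lemma A_theta_uniqueness f : A_theta_function p m s f ->
  (forall i, f (b i) = 0) -> forall z, z != 0 -> f z = 0.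
Proof.
move=> hf fb; have [m0 _ _ _] := hf.
(* [f] is put first, in front of the interpolating functions. *)
pose g (i : 'I_m.+1) := if unlift ord0 i is Some j then lagrange_theta j else f.
have hg i : A_theta_function p m s (g i).
  by rewrite /g; case: unliftP => [j _|_] //; exact: lagrange_thetaP.
have holg i (j : int) : holomorphic_on Cstar (fun z => g i z * z ^ j).
  have [_ _ h _] := hg i; exact: (holomorphicM h (@holomorphic_exprz R j)).
pose A : 'M[R[i]]_(m.+1, m) := \matrix_(i, j) circle_int (fun z => g i z * z ^ j%:Z).
have [v v0 vA] : exists2 v : 'rV[R[i]]_m.+1, v != 0 & v *m A = 0.
  have kA : kermx A != 0.
    rewrite -mxrank_eq0 mxrank_ker -lt0n subn_gt0 ltnS; exact: rank_leq_col.
  by exists (nz_row (kermx A)); [rewrite nz_row_eq0|apply/sub_kermxP; exact: nz_row_sub].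
have hz : forall z, z != 0 -> \sum_i v 0 i * g i z = 0.
  apply: (A_theta_laurent0 (A_theta_lincomb (v 0) m0 s_neq0 hg)) => j.
  have vAj : \sum_i v 0 i * circle_int (fun z => g i z * z ^ j%:Z) = 0.
    have := congr1 (fun w : 'rV_m => w 0 j) vA; rewrite !mxE => {2}<-.
    by apply: eq_bigr => i _; rewrite mxE.
  apply: (etrans _ vAj).
  rewrite -circle_int_lincomb; last by move=> i; exact: holg.
  apply: eq_circle_int => z z0 /=; rewrite mulr_suml; apply: eq_bigr => i _.
  by rewrite mulrA.
have vj (j : 'I_m) : v 0 (lift ord0 j) = 0.
  have := hz _ (b_neq0 j); rewrite big_ord_recl /= {1}/g unlift_none fb mulr0 add0r.
  rewrite (bigD1 j) //= big1 => [|k kj]; last first.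
    by rewrite /g liftK lagrange_theta_off // mulr0.
  rewrite addr0 /g liftK => /eqP; rewrite mulf_eq0 (negbTE (lagrange_theta_diag j)) orbF.
  by move/eqP.
have v00 : v 0 ord0 != 0.
  apply: contra v0 => /eqP v00; apply/eqP/rowP => i; rewrite mxE.
  by have [j ->|->] := unliftP ord0 i.
move=> z z0; have := hz z z0; rewrite big_ord_recl big1 => [|j _]; last by rewrite vj mul0r.
rewrite addr0 /g unlift_none => /eqP; rewrite mulf_eq0 (negbTE v00) /=.
by move/eqP.
Qed.

End Interpolation.
End ThetaFunctions.

(** * Moving points into general position *)

Section GenericPerturbation.
Variables (R : realType) (p : R[i]).
Hypotheses (p_neq0 : p != 0) (p_lt1 : normc p < 1).

Local Notation Cstar := [set z : R[i] | z != 0].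

Let normcXn (z : R[i]) n : normc (z ^+ n) = normc z ^+ n.
Proof. by elim: n => [|n IH]; rewrite ?expr0 ?normc1 // !exprS normcM IH. Qed.

Let ln_normc_exprz (k : int) : ln (normc (p ^ k)) = k%:~R * ln (normc p).
Proof.
have q0 := normc_gt0 p_neq0.
case: k => n; first by rewrite -[p ^ n]/(p ^+ n) normcXn lnXn // mulr_natl.
rewrite NegzE -invr_expz normcV -[p ^ n.+1]/(p ^+ n.+1) normcXn lnV ?posrE ?exprn_gt0 //.
by rewrite lnXn // rmorphN /= mulNr mulr_natl.
Qed.

(** If [theta p (c * r ^+ e)] vanishes, then [c * r ^+ e] is a power of [p].  The absolute
    values of these powers form a discrete set, and for [r] slightly larger than 1
    that of [c * r ^+ e] lies strictly between two consecutive ones. *)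
Lemma theta_neq0_right (c : R[i]) (e : nat) : c != 0 ->
  (0 < e)%N || (theta p c != 0) ->
  exists2 d : R, 0 < d & forall r, 1 < r < 1 + d -> theta p (c * r%:C ^+ e) != 0.
Proof.
move=> c0; have [->|e0 _] := posnP e.
  by move=> /= tc; exists 1 => // r _; rewrite expr0 mulr1.
have q0 := normc_gt0 p_neq0; have nc0 := normc_gt0 c0.
(* [m] locates the absolute value of [c] among those of the powers of [p]. *)
pose l := - ln (normc p); pose L := ln (normc c); pose m := Num.floor (L / l).
have l0 : 0 < l by rewrite /l oppr_gt0 ln_lt0 // q0 p_lt1.
have /andP[mL Lm] : m%:~R * l <= L < (m + 1)%:~R * l.
  by rewrite -ler_pdivlMr // -ltr_pdivrMr //; exact: floor_itv.
have er0 : 0 < e%:R :> R by rewrite ltr0n.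
exists (((m + 1)%:~R * l - L) / e%:R); first by rewrite divr_gt0 // subr_gt0.
move=> r /andP[r1 rd]; have r0 : 0 < r by rewrite (lt_trans ltr01).
have rC0 : r%:C != 0 by rewrite eq_complex /= eqxx andbT gt_eqF.
apply/eqP => /(theta_zero p_neq0 p_lt1)[|k].
  by rewrite mulf_neq0 // expf_neq0.
move=> /(congr1 (fun z => ln (normc z))); rewrite ln_normc_exprz normcM normcXn.
have -> : normc r%:C = r by rewrite /= expr0n addr0 sqrtr_sqr ger0_norm // ltW.
rewrite lnM ?posrE ?exprn_gt0 // lnXn // -/L => eqk.
have lnr0 : 0 < ln r by rewrite ln_gt0.
have lnr : ln r < ((m + 1)%:~R * l - L) / e%:R.
  have := @le_ln1Dx R (r - 1); rewrite addrCA subrr addr0.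
  by move=> /(_ _)/le_lt_trans; apply; lra.
rewrite ltr_pdivlMr // mulr_natr in lnr.
have elnr : 0 < ln r *+ e by rewrite mulrn_wgt0.
have kl : k%:~R * ln (normc p) = (- k)%:~R * l by rewrite rmorphN /= /l mulrNN.
rewrite kl in eqk.
have k1 : m%:~R * l < (- k)%:~R * l by rewrite -eqk; lra.
have k2 : (- k)%:~R * l < (m + 1)%:~R * l by rewrite -eqk; lra.
move: k1 k2; rewrite !ltr_pM2r // !ltr_int => k1 k2.
by move: k2; rewrite ltzD1 leNgt k1.
Qed.

Lemma near1_forall (I : eqType) (s : seq I) (P : I -> R -> Prop) :
  (forall i, i \in s -> exists2 d : R, 0 < d & forall r, 1 < r < 1 + d -> P i r) ->
  exists2 d : R, 0 < d & forall i r, i \in s -> 1 < r < 1 + d -> P i r.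
Proof.
elim: s => [|i s IH] H; first by exists 1.
have [d1 d10 H1] := H i (mem_head i s).
have [|d2 d20 H2] := IH; first by move=> j js; apply: H; rewrite in_cons js orbT.
exists (Num.min d1 d2); first by rewrite lt_min d10.
move=> j r; rewrite in_cons => /orP[/eqP->|js] /andP[r1]; rewrite -ltrBlDl lt_min => /andP[rd1 rd2].
  by apply: H1; rewrite r1 -ltrBlDl.
by apply: H2 => //; rewrite r1 -ltrBlDl.
Qed.

(** [H] vanishes at points tending to 1, hence at 1 by continuity. *)
Lemma generic_perturbation (I : finType) (c : I -> R[i]) (e : I -> nat) (H : R[i] -> R[i]) :
  (forall i, c i != 0) -> (forall i, (0 < e i)%N || (theta p (c i) != 0)) ->
  holomorphic_on Cstar H ->
  (forall z, z != 0 -> (forall i, theta p (c i * z ^+ e i) != 0) -> H z = 0) ->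
  H 1 = 0.
Proof.
move=> c0 he hH Hz; apply/eqP; apply/negPn/negP => H1.
have [|d d0 Hd] := @near1_forall I (enum I) (fun i r => theta p (c i * r%:C ^+ e i) != 0).
  by move=> i _; exact: theta_neq0_right.
have [D HD] := derivable_eps (hH 1 (oner_neq0 _)).
have nH := normc_gt0 H1; have nD := normc_ge0 D.
have [d' d'0 {}HD] := HD 1 ltr01.
have K0 : 0 < normc D + 1 by lra.
have d3 : 0 < normc (H 1) / (normc D + 1) by rewrite divr_gt0.
pose h := Num.min (Num.min d d') (normc (H 1) / (normc D + 1)) / 2.
have h0 : 0 < h by rewrite divr_gt0 // !lt_min d0 d'0.
have h2 : h < Num.min (Num.min d d') (normc (H 1) / (normc D + 1)).
  by rewrite ltr_pdivrMr // mulrDr mulr1 ltrDl !lt_min d0 d'0.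
move: h2; rewrite !lt_min => /andP[/andP[hd hd'] hn].
pose r := 1 + h.
have r1 : 1 < r < 1 + d by rewrite /r; apply/andP; split; lra.
have rC0 : r%:C != 0.
  by rewrite eq_complex /= eqxx andbT gt_eqF // /r addr_gt0.
have Hr : H r%:C = 0 by apply: Hz => // i; apply: Hd => //; rewrite mem_enum.
have rh : r%:C - 1 = h%:C by rewrite /r rmorphD rmorph1 addrAC subrr add0r.
have nh : normc h%:C = h by rewrite /= expr0n addr0 sqrtr_sqr ger0_norm // ltW.
have := HD r%:C; rewrite rh nh Hr sub0r mul1r => /(_ hd') le.
have : normc (H 1) <= (normc D + 1) * h.
  have -> : H 1 = - (- H 1 - D * h%:C) - D * h%:C by ring.
  apply: (le_trans (normcD _ _)); rewrite normcN normcN normcM nh mulrDl mul1r addrC.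
  by rewrite lerD2l.
by rewrite ltr_pdivlMr // in hn; rewrite leNgt mulrC hn.
Qed.

End GenericPerturbation.

(** * The determinant at general points *)

Section LastIndex.
Variable C : comNzRingType.

Lemma prod_recr n (Q : pred 'I_n.+1) (F : 'I_n.+1 -> C) :
  \prod_(i | Q i) F i = (\prod_(i < n | Q (lift ord_max i)) F (lift ord_max i))
                        * (if Q ord_max then F ord_max else 1).
Proof.
rewrite big_mkcond big_ord_recr /=; congr (_ * _); rewrite [RHS]big_mkcond.
apply: eq_bigr => i _.
by have -> : widen_ord (leqnSn n) i = lift ord_max i by apply: val_inj; exact: (esym (lift_max i)).
Qed.

Lemma prod_recr_gt n (i : 'I_n) (F : 'I_n.+1 -> C) :
  \prod_(j < n.+1 | (lift ord_max i < j)%N) F j =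
  (\prod_(j < n | (i < j)%N) F (lift ord_max j)) * F ord_max.
Proof.
rewrite prod_recr [X in if X then _ else _](_ : _ = true); last first.
  by rewrite lift_max; exact: ltn_ord.
by congr (_ * _); apply: eq_bigl => j; rewrite !lift_max.
Qed.

Lemma prod_recr_le n (i : 'I_n) (F : 'I_n.+1 -> C) :
  \prod_(j < n.+1 | (j <= lift ord_max i)%N) F j =
  \prod_(j < n | (j <= i)%N) F (lift ord_max j).
Proof.
rewrite prod_recr [X in if X then _ else _](_ : _ = false); last first.
  by apply/negbTE; rewrite -ltnNge lift_max; exact: ltn_ord.
by rewrite mulr1; apply: eq_bigl => j; rewrite !lift_max.
Qed.

Lemma prod_gt_max n (F : 'I_n.+1 -> C) : \prod_(j < n.+1 | ((ord_max : 'I_n.+1) < j)%N) F j = 1.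
Proof. by apply: big_pred0 => j; apply/negbTE; rewrite -leqNgt -ltnS ltn_ord. Qed.

Definition ext (T : Type) n (x : 'I_n -> T) (y : T) (i : 'I_n.+1) : T :=
  if unlift ord_max i is Some j then x j else y.

Lemma ext_lift (T : Type) n (x : 'I_n -> T) y j : ext x y (lift ord_max j) = x j.
Proof. by rewrite /ext liftK. Qed.

Lemma ext_max (T : Type) n (x : 'I_n -> T) y : ext x y ord_max = y.
Proof. by rewrite /ext unlift_none. Qed.

Lemma prod_ext n (x : 'I_n -> C) y : \prod_i ext x y i = (\prod_i x i) * y.
Proof.
by rewrite prod_recr ext_max; congr (_ * _); apply: eq_bigr => i _; rewrite ext_lift.
Qed.

End LastIndex.

Section DeterminantIdentity.
Variables (R : realType) (p : R[i]).
Hypotheses (p_neq0 : p != 0) (p_lt1 : normc p < 1).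

Local Notation Cstar := [set z : R[i] | z != 0].

Definition theta_entry n (a : 'I_n -> R[i]) (P : 'I_n -> R[i] -> R[i]) (j : 'I_n) (z : R[i]) :=
  P j z * \prod_(k < n | (j < k)%N) theta p (a k * z).

Definition theta_mx n (x a : 'I_n -> R[i]) (P : 'I_n -> R[i] -> R[i]) : 'M[R[i]]_n :=
  \matrix_(i, j) theta_entry a P j (x i).

Definition theta_vandermonde n (x a : 'I_n -> R[i]) : R[i] :=
  \prod_(i < n) \prod_(j < n | (i < j)%N) (a j * x j * theta p (x i / x j)).

Definition theta_rhs n (x a : 'I_n -> R[i]) (t : R[i]) (P : 'I_n -> R[i] -> R[i]) : R[i] :=
  theta p (t * (\prod_(i < n) a i) * (\prod_(i < n) x i)) / theta p t
  * (\prod_(i < n) P i (1 / a i)) * theta_vandermonde x a.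

Definition theta_family n (a : 'I_n -> R[i]) (t : R[i]) (P : 'I_n -> R[i] -> R[i]) :=
  forall j : 'I_n, A_theta_function p j.+1 (t * \prod_(k < n | (k <= j)%N) a k) (P j).

Lemma A_theta_mul_prod (I : Type) (r : seq I) (Q : pred I) (c : I -> R[i]) m s f :
  (forall i, c i != 0) -> A_theta_function p m s f ->
  A_theta_function p (m + count Q r) (s * \prod_(i <- r | Q i) c i)
    (fun z => f z * \prod_(i <- r | Q i) theta p (c i * z)).
Proof.
move=> c0 [m0 s0 hf qf]; split.
- by rewrite addn_gt0 m0.
- rewrite mulf_neq0 //; apply: (big_ind (fun z => z != 0)) => //.

  exact: mulf_neq0.
- have hp : holomorphic_on Cstar (fun z => \prod_(i <- r | Q i) theta p (c i * z)).
    apply: (@holomorphic_prod R I r Q (fun i z => theta p (c i * z))) => i _.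
    exact: (holomorphic_dilation (c0 i) (theta_holomorphic p_lt1)).
  exact: (holomorphicM hf hp).
- move=> x x0; rewrite qf //.
  have -> : \prod_(i <- r | Q i) theta p (c i * (p * x)) =
    (-1) ^+ count Q r / ((\prod_(i <- r | Q i) c i) * x ^+ count Q r) *
    \prod_(i <- r | Q i) theta p (c i * x).
    elim: r => [|i r IH]; first by rewrite !big_nil /= !expr0 !mulr1 divr1.
    rewrite !big_cons /=; case: (Q i); last by rewrite add0n IH.
    by rewrite add1n IH (mulrCA (c i)) theta_p ?mulf_neq0 // !exprS !invfM; ring.
  by rewrite !exprD !invfM; ring.
Qed.

(** The factors indexed by k > j raise the degree from j + 1 to n and complete the
    product of the a_k in the norm. *)
Lemma theta_entry_A_theta n (a : 'I_n -> R[i]) t P j :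
  (forall i, a i != 0) -> theta_family a t P ->
  A_theta_function p n (t * \prod_i a i) (theta_entry a P j).
Proof.
move=> a0 hP; have := A_theta_mul_prod (index_enum 'I_n) (fun k : 'I_n => (j < k)%N) a0 (hP j).
have -> : (j.+1 + count (fun k : 'I_n => (j < k)%N) (index_enum 'I_n) = n)%N.
  rewrite -sum1_count -[RHS](card_ord n) -sum1_card.
  rewrite [RHS](bigID (fun k : 'I_n => (k < j.+1)%N)) /=; congr (_ + _)%N.
    by rewrite (big_ord_narrow (ltn_ord j)) sum1_card card_ord.
  by apply: eq_bigl => k; rewrite -leqNgt.
have -> : t * \prod_(k < n | (k <= j)%N) a k * \prod_(k < n | (j < k)%N) a k = t * \prod_i a i.
  rewrite -mulrA; congr (t * _); rewrite [RHS](bigID (fun k : 'I_n => (k <= j)%N)) /=.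
  by congr (_ * _); apply: eq_bigl => k; rewrite ltnNge.
exact.
Qed.

Lemma theta_vandermonde_recr n (x : 'I_n -> R[i]) (y : R[i]) (a : 'I_n.+1 -> R[i]) :
  theta_vandermonde (ext x y) a =
  theta_vandermonde x (a \o lift ord_max) *
  \prod_(i < n) (a ord_max * y * theta p (x i / y)).
Proof.
rewrite /theta_vandermonde prod_recr [X in _ * X]prod_gt_max mulr1.
rewrite -big_split; apply: eq_bigr => i _.
rewrite prod_recr_gt !ext_max !ext_lift; congr (_ * _).
by apply: eq_bigr => j _; rewrite !ext_lift.
Qed.

(** The factor of index n in the entries of row i depends only on the row. *)
Lemma theta_mx_minor n (x : 'I_n -> R[i]) (y : R[i]) (a : 'I_n.+1 -> R[i]) P :
  row' ord_max (col' ord_max (theta_mx (ext x y) a P)) =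
  diag_mx (\row_i theta p (a ord_max * x i)) *m
  theta_mx x (a \o lift ord_max) (P \o lift ord_max).
Proof.
apply/matrixP => i j; rewrite mul_diag_mx !mxE ext_lift /theta_entry.
by rewrite prod_recr_gt [LHS]mulrA [LHS]mulrC.
Qed.

Lemma theta_family_lift n (a : 'I_n.+1 -> R[i]) t P :
  theta_family a t P -> theta_family (a \o lift ord_max) t (P \o lift ord_max).
Proof.
move=> hP j; have := hP (lift ord_max j); rewrite prod_recr_le lift_max.
exact.
Qed.

Lemma theta_neq0V z : z != 0 -> theta p z != 0 -> theta p z^-1 != 0.
Proof. by move=> z0 tz; rewrite theta_V // mulf_neq0 // oppr_eq0 invr_eq0. Qed.

Section Step.
Variables (n : nat) (x : 'I_n -> R[i]) (a : 'I_n.+1 -> R[i]) (t : R[i]).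
Variable P : 'I_n.+1 -> R[i] -> R[i].
Hypotheses (x_neq0 : forall i, x i != 0) (a_neq0 : forall i, a i != 0).
Hypotheses (t_neq0 : t != 0) (theta_t : theta p t != 0) (hP : theta_family a t P).

Let a' := a \o lift ord_max.
Let P' := P \o lift ord_max.
Let am := a ord_max.
Let s := t * \prod_i a i.

Let s_neq0 : s != 0.
Proof. by rewrite mulf_neq0 //; apply/prodf_neq0. Qed.

Let sE : s = t * (\prod_i a' i) * am.
Proof. by rewrite /s prod_recr mulrA. Qed.

Let K : R[i] := (\prod_i P i (1 / a i)) / theta p t * theta_vandermonde x a' *
  \prod_(i < n) - (am * x i).

Let c : 'I_n.+1 -> R[i] := ext (fun i => (x i)^-1) (s * \prod_i x i).

Let c_neq0 i : c i != 0.
Proof.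
rewrite /c /ext; case: unlift => [j|]; first by rewrite invr_eq0.
by rewrite mulf_neq0 //; apply/prodf_neq0.
Qed.

(** As a function of the last point, the right-hand side is a product of theta
    functions: turning theta(x/y) into theta(y/x) produces a factor x/y,
    which cancels the factor y in front of it. *)
Lemma theta_rhs_last y : y != 0 ->
  theta_rhs (ext x y) a t P = K * \prod_i theta p (c i * y).
Proof.
move=> y0; rewrite /theta_rhs theta_vandermonde_recr prod_ext.
have -> : \prod_i theta p (c i * y) =
    (\prod_(i < n) theta p ((x i)^-1 * y)) * theta p (s * (\prod_i x i) * y).
  by rewrite prod_recr /c ext_max; congr (_ * _); apply: eq_bigr => i _; rewrite ext_lift.
have -> : \prod_(i < n) (a ord_max * y * theta p (x i / y)) =
    (\prod_(i < n) - (am * x i)) * \prod_(i < n) theta p ((x i)^-1 * y).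
  rewrite -big_split; apply: eq_bigr => i _ /=.
  have -> : x i / y = ((x i)^-1 * y)^-1 by rewrite invfM invrK mulrC.
  rewrite (theta_V p_neq0 p_lt1); last by rewrite mulf_neq0 // invr_eq0.
  by rewrite invfM invrK /am; field.
have -> : t * (\prod_i a i) * ((\prod_i x i) * y) = s * (\prod_i x i) * y by rewrite mulrA.
by rewrite /K; ring.
Qed.

Let detf : R[i] -> R[i] := fun y => \det (theta_mx (ext x y) a P).

(** Expansion along the last row, whose cofactors do not involve the last point. *)
Lemma det_theta_mx_A_theta : A_theta_function p n.+1 s detf.
Proof.
(* Any value can stand for the last point here. *)
pose C j := cofactor (theta_mx (ext x 1) a P) ord_max j.
have -> : detf = fun y => \sum_j C j * theta_entry a P j y.
  apply/funext => y; rewrite /detf (expand_det_row _ ord_max); apply: eq_bigr => j _.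
  rewrite [RHS]mulrC mxE ext_max; congr (_ * _); rewrite /C /cofactor; congr (_ * \det _).
  by apply/matrixP => i k; rewrite !mxE !ext_lift.
by apply: A_theta_lincomb => // j; exact: theta_entry_A_theta.
Qed.

Lemma det_theta_mx_equal_points i : detf (x i) = 0.
Proof.
apply: (@determinant_alternate _ _ _ (lift ord_max i) ord_max).
  by rewrite eq_sym neq_lift.
by move=> j; rewrite !mxE ext_lift ext_max.
Qed.

Lemma det_theta_mx_last : detf am^-1 =
  P ord_max (1 / am) * (\prod_i theta p (am * x i)) * \det (theta_mx x a' P').
Proof.
rewrite /detf (expand_det_row _ ord_max) (bigD1 ord_max) //= big1 ?addr0.
  rewrite mxE ext_max /cofactor theta_mx_minor det_mulmx det_diag -signr_odd addnn odd_double.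
  rewrite expr0 mul1r /theta_entry prod_gt_max mulr1 div1r -mulrA.
  by congr (_ * (_ * _)); apply: eq_bigr => i _; rewrite mxE.
move=> j jm; rewrite mxE ext_max /theta_entry (bigD1 ord_max) /=; last first.
  by rewrite ltn_neqAle -ltnS ltn_ord andbT.
by rewrite mulfV // theta1 // !(mul0r, mulr0).
Qed.

Hypothesis x_distinct : forall i k : 'I_n, (i < k)%N -> theta p (x k / x i) != 0.
Hypothesis x_a_distinct : forall i, theta p (am * x i) != 0.
Hypothesis x_generic : theta p (t * (\prod_i a' i) * \prod_i x i) != 0.
Hypothesis IH : \det (theta_mx x a' P') = theta_rhs x a' t P'.

(** The difference of both sides is a theta function vanishing at the [x i] and at
    the inverse of the last parameter; the hypotheses say that these nodes satisfy
    the conditions of [A_theta_uniqueness]. *)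
Lemma det_theta_mx_generic y : y != 0 -> detf y = theta_rhs (ext x y) a t P.
Proof.
move=> y0; rewrite theta_rhs_last //; set G := fun y => \prod_i theta p (c i * y).
have am0 : am != 0 by exact: a_neq0.
have hG : A_theta_function p n.+1 s G.
  have -> : s = \prod_i c i; last exact: A_theta_prod.
  by rewrite prod_ext prodfV mulrC mulfK //; apply/prodf_neq0.
pose g (b : bool) := if b then detf else G.
pose v (b : bool) := if b then 1 else - K.
have hg b : A_theta_function p n.+1 s (g b).
  by case: b => //; exact: det_theta_mx_A_theta.
have hF := A_theta_lincomb v (ltn0Sn n) s_neq0 hg.
pose nodes : 'I_n.+1 -> R[i] := ext x am^-1.
have nodes0 i : nodes i != 0.
  by rewrite /nodes /ext; case: unlift => [j|] //; rewrite invr_eq0.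
have FE z : \sum_b v b * g b z = detf z - K * G z.
  by rewrite big_bool /= /v /g mul1r mulNr.
suff : \sum_b v b * g b y = 0 by rewrite FE => /eqP; rewrite subr_eq0 => /eqP.
apply: (@A_theta_uniqueness _ _ p_neq0 p_lt1 n.+1 s nodes s_neq0 nodes0) hF _ y y0.
- move=> i k; rewrite /nodes.
  have [i' ->|->] := unliftP ord_max i; have [k' ->|->] := unliftP ord_max k; last by rewrite eqxx.
  + rewrite !ext_lift (inj_eq lift_inj) neq_ltn => /orP[] ik; last exact: x_distinct.
    have -> : x i' / x k' = (x k' / x i')^-1 by rewrite invfM invrK mulrC.
    by rewrite theta_neq0V // ?x_distinct // mulf_neq0 // invr_eq0.
  + by rewrite ext_lift ext_max invrK mulrC.
  + rewrite ext_lift ext_max -invfM theta_neq0V // ?mulf_neq0 //.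
- rewrite /nodes prod_ext sE.
  have -> : t * (\prod_i a' i) * am * ((\prod_i x i) / am) =
    t * (\prod_i a' i) * (\prod_i x i) by field.
  exact: x_generic.
- move=> i; rewrite FE /nodes; have [i' ->|->] := unliftP ord_max i.
    rewrite ext_lift det_theta_mx_equal_points /G (bigD1 (lift ord_max i')) //= /c ext_lift.
    by rewrite mulVf // theta1 // mul0r mulr0 subrr.
  rewrite ext_max det_theta_mx_last IH -theta_rhs_last ?invr_eq0 //.
  rewrite /theta_rhs theta_vandermonde_recr prod_ext -/a' -/am.
  have -> : t * (\prod_i a i) * ((\prod_i x i) / am) = t * (\prod_i a' i) * \prod_i x i.
    by rewrite -/s sE; field.
  have -> : \prod_(i < n) (am / am * theta p (x i / am^-1)) =
      \prod_(i < n) theta p (am * x i).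
    by apply: eq_bigr => j _; rewrite mulfV // mul1r invrK mulrC.
  have -> : \prod_i P i (1 / a i) = (\prod_i P' i (1 / a' i)) * P ord_max (1 / am).
    by rewrite prod_recr.
  by ring.
Qed.

End Step.
End DeterminantIdentity.

(** * The determinant at arbitrary points *)

Section GeneralPoints.
Variables (R : realType) (p : R[i]).
Hypotheses (p_neq0 : p != 0) (p_lt1 : normc p < 1).

Local Notation Cstar := [set z : R[i] | z != 0].

Lemma holomorphic_compose (F g : R[i] -> R[i]) :
  holomorphic_on Cstar F -> holomorphic_on Cstar g -> (forall z, z != 0 -> g z != 0) ->
  holomorphic_on Cstar (fun z => F (g z)).
Proof.
move=> hF hg g0 z z0.
exact: (@derivable_compC R F g z (hg z z0) (hF (g z) (g0 z z0))).
Qed.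

Section Family.
Variables (n : nat) (x : 'I_n -> R[i] -> R[i]) (a : 'I_n -> R[i]) (t : R[i]).
Variable P : 'I_n -> R[i] -> R[i].
Hypotheses (x_hol : forall i, holomorphic_on Cstar (x i)).
Hypotheses (x_neq0 : forall i z, z != 0 -> x i z != 0).
Hypotheses (a_neq0 : forall i, a i != 0) (t_neq0 : t != 0).
Hypothesis P_hol : forall j, holomorphic_on Cstar (P j).

Let theta_hol := theta_holomorphic p_lt1.

Lemma det_theta_mx_holomorphic :
  holomorphic_on Cstar (fun z => \det (theta_mx p (fun i => x i z) a P)).
Proof.
pose term (s : 'S_n) (z : R[i]) := (-1) ^+ s * \prod_i theta_entry p a P (s i) (x i z).
have -> : (fun z => \det (theta_mx p (fun i => x i z) a P)) = fun z => \sum_s term s z.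
  apply/funext => z; rewrite /determinant; apply: eq_bigr => s _; rewrite /term; congr (_ * _).
  by apply: eq_bigr => i _; rewrite mxE.
apply: (@holomorphic_sum R _ _ _ term) => s _.
apply: (holomorphicM (@holomorphic_cst R _)).
apply: (@holomorphic_prod R _ _ _ (fun i z => theta_entry p a P (s i) (x i z))) => i _.
apply: (holomorphicM (holomorphic_compose (@P_hol _) (@x_hol i) (@x_neq0 i))).
apply: (@holomorphic_prod R _ _ _ (fun k z => theta p (a k * x i z))) => k _.
exact: (holomorphic_compose (holomorphic_dilation (a_neq0 k) theta_hol) (@x_hol i) (@x_neq0 i)).
Qed.

Lemma theta_rhs_holomorphic :
  holomorphic_on Cstar (fun z => theta_rhs p (fun i => x i z) a t P).
Proof.
have c0 : t * \prod_i a i != 0 by rewrite mulf_neq0 //; apply/prodf_neq0.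
have hx : holomorphic_on Cstar (fun z => \prod_i x i z).
  by apply: (@holomorphic_prod R _ (index_enum 'I_n) xpredT x) => i _; exact: x_hol.
have x0 z : z != 0 -> \prod_i x i z != 0.
  by move=> z0; apply/prodf_neq0 => i _; exact: x_neq0.
have h1 := holomorphic_compose (holomorphic_dilation c0 theta_hol) hx x0.
have h2 (k : R[i]) := @holomorphic_cst R k.
have hV : holomorphic_on Cstar (fun z => theta_vandermonde p (fun i => x i z) a).
  apply: (@holomorphic_prod R _ (index_enum 'I_n) xpredT (fun i z =>
    \prod_(j < n | (i < j)%N) (a j * x j z * theta p (x i z / x j z)))) => i _.
  apply: (@holomorphic_prod R _ (index_enum 'I_n) (fun j : 'I_n => (i < j)%N) (fun j z =>
    (a j * x j z * theta p (x i z / x j z)))) => j _.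
  have hq : holomorphic_on Cstar (fun z => x i z / x j z).
    exact: (holomorphicM (@x_hol i)
              (holomorphic_compose (@holomorphic_inv R) (@x_hol j) (@x_neq0 j))).
  have q0 z : z != 0 -> x i z / x j z != 0.
    by move=> z0; rewrite mulf_neq0 ?invr_eq0 ?x_neq0.
  exact: (holomorphicM (holomorphicM (h2 (a j)) (@x_hol j)) (holomorphic_compose theta_hol hq q0)).
exact: (holomorphicM (holomorphicM (holomorphicM h1 (h2 _)) (h2 _)) hV).
Qed.

End Family.

(** The first n points are moved along [x i * z ^+ i.+1], the last one is kept fixed.
    The exponents are distinct and positive, so each of the genericity conditions
    becomes the nonvanishing of theta along a multiple of a nonconstant power of [z]
    (when n = 0, one of them is constant). *)
Theorem det_theta_mx n (x a : 'I_n -> R[i]) (t : R[i]) (P : 'I_n -> R[i] -> R[i]) :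
  (forall i, x i != 0) -> (forall i, a i != 0) -> t != 0 -> theta p t != 0 ->
  theta_family p a t P -> \det (theta_mx p x a P) = theta_rhs p x a t P.
Proof.
elim: n x a P => [|n IH] x a P x0 a0 t0 tht hP.
  rewrite det_mx00 /theta_rhs /theta_vandermonde !big_ord0 !mulr1.
  by rewrite divff.
pose x' (j : 'I_n) := x (lift ord_max j).
(* The exponents of the curve along which the points move. *)
pose w (i : 'I_n.+1) : nat := if unlift ord_max i is Some j then j.+1 else 0.
pose xz (i : 'I_n.+1) (z : R[i]) := x i * z ^+ w i.
pose H z := \det (theta_mx p (xz ^~ z) a P) - theta_rhs p (xz ^~ z) a t P.
have xzh i : holomorphic_on Cstar (xz i).
  exact: (holomorphicM (@holomorphic_cst R _) (@holomorphicX R _ (w i) (@holomorphic_id R))).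
have xz0 i z : z != 0 -> xz i z != 0 by move=> z0; rewrite mulf_neq0 // expf_neq0.
have Ph j : holomorphic_on Cstar (P j) by have [_ _ h _] := hP j.
have hH : holomorphic_on Cstar H.
  have h1 := det_theta_mx_holomorphic xzh xz0 a0 Ph.
  have h2 := theta_rhs_holomorphic (P := P) xzh xz0 a0 t0.
  have -> : H = fun z => \det (theta_mx p (xz ^~ z) a P) + (-1) * theta_rhs p (xz ^~ z) a t P.
    by apply/funext => z; rewrite mulN1r.
  exact: (holomorphicD h1 (holomorphicM (@holomorphic_cst R _) h2)).
suff H1 : H 1 = 0.
  have xE : xz ^~ 1 = x by apply/funext => i; rewrite /xz expr1n mulr1.
  by move/eqP: H1; rewrite /H xE subr_eq0 => /eqP.
pose a' := a \o lift ord_max.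
(* The three kinds of genericity conditions; pairs with k <= i get a dummy one.
     The last condition is constant when n = 0, and is then a hypothesis. *)
pose e (u : 'I_n * 'I_n + 'I_n + unit) : nat := match u with
  | inl (inl (i, k)) => if (i < k)%N then (k - i)%N else 1%N
  | inl (inr i) => i.+1
  | inr _ => (\sum_(i < n) i.+1)%N end.
pose c (u : 'I_n * 'I_n + 'I_n + unit) : R[i] := match u with
  | inl (inl (i, k)) => if (i < k)%N then x' k / x' i else 1
  | inl (inr i) => a ord_max * x' i
  | inr _ => t * (\prod_i a' i) * \prod_i x' i end.
apply: (@generic_perturbation R p p_neq0 p_lt1 _ c e H) => //.
- move=> [[[i k]|i]|[]] /=; first case: ifP => _.
  + by rewrite mulf_neq0 // ?invr_eq0 /x'.
  + exact: oner_neq0.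
  + by rewrite mulf_neq0 // /x'.
  + apply: mulf_neq0; first apply: mulf_neq0 => //.
      by apply/prodf_neq0 => i _; exact: a0.
    by apply/prodf_neq0 => i _; exact: x0.
- move=> [[[i k]|i]|[]] //=; first by case: ifP => //; rewrite subn_gt0 => ->.
  case: n IH x a P x0 a0 hP x' w xz H xzh xz0 Ph hH a' e c => [|n] *.
    by rewrite !big_ord0 !mulr1 tht orbT.
  by rewrite big_ord_recl.
- move=> z z0 gen; apply/eqP; rewrite subr_eq0; apply/eqP.
  pose x'z (j : 'I_n) := x' j * z ^+ j.+1.
  have x'z0 j : x'z j != 0 by rewrite mulf_neq0 ?expf_neq0 // /x'.
  have -> : xz ^~ z = ext x'z (x ord_max).
    apply/funext => i; rewrite /ext /xz /w; case: (unliftP ord_max i) => [j ->|->] //=.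
    by rewrite expr0 mulr1.
  apply: det_theta_mx_generic => //.
  + move=> i k ik; have := gen (inl (inl (i, k))); rewrite /c /e ik.
    have -> // : x' k / x' i * z ^+ (k - i) = x'z k / x'z i.
    rewrite /x'z -(subnK (ltnW ik)) -addnS exprD subnK ?(ltnW ik) //.
    by field; rewrite /x' x0 expf_neq0.
  + move=> i; have := gen (inl (inr i)); rewrite /c /e.
    by have -> // : a ord_max * x' i * z ^+ i.+1 = a ord_max * x'z i by rewrite mulrA.
  + have := gen (inr tt); rewrite /c /e.
    have -> // : t * (\prod_i a' i) * (\prod_i x' i) * z ^+ (\sum_(i < n) i.+1) =
      t * (\prod_i a' i) * \prod_i x'z i.
    by rewrite /x'z big_split /= -mulrA expr_sum.
  + exact: (IH _ _ _ x'z0 (fun i => a0 _) t0 tht (theta_family_lift hP)).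
Qed.

End GeneralPoints.

Theorem theorem4p4 (R : realType) (p : R[i]) (hp0 : 0 < `|p|) (hp1 : `|p| < 1)
    (n : nat) (x a : 'I_n -> R[i]) (t : R[i])
    (hx : forall i : 'I_n, x i != 0) (ha : forall i : 'I_n, a i != 0)
    (ht : t != 0) (htheta : theta p t != 0)
    (P : 'I_n -> R[i] -> R[i])
    (hP : forall j : 'I_n,
       A_theta_function p j.+1 (t * \prod_(k < n | (k <= j)%N) a k) (P j)) :
  \det (\matrix_(i < n, j < n)
          (P j (x i) * \prod_(k < n | (j < k)%N) theta p (a k * x i))) =
  theta p (t * (\prod_(i < n) a i) * (\prod_(i < n) x i)) / theta p t
  * (\prod_(i < n) P i (1 / a i))
  * \prod_(i < n) \prod_(j < n | (i < j)%N) (a j * x j * theta p (x i / x j)).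
Proof.
have p_neq0 : p != 0 by rewrite -normr_gt0.
have p_lt1 : normc p < 1 by rewrite -ltcR.
exact: (det_theta_mx p_neq0 p_lt1 hx ha ht htheta hP).
Qed.
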